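(* Let $\mathcal{G}$ be a proper minor-closed family of graphs (for instance, planar graphs). There is a constant $c_{\mathcal{G}}$ depending only on $\mathcal{G}$ such that: (i) for every graph $G=(V,E)\in\mathcal{G}$ and every cost function $c:V\to\mathbb{R}_{\ge0}$, the minimum cost of a dominating set of $G$ is at most $c_{\mathcal{G}}$ times the optimal value of the LP $\mathrm{DS\text{-}LP}(G,c)$; and (ii) there is a polynomial-time algorithm that, given such $G$, $c$ and any feasible solution $x$ of $\mathrm{DS\text{-}LP}(G,c)$, outputs a dominating set $D$ of $G$ with $\sum_{v\in D}c(v)\le c_{\mathcal{G}}\sum_{v\in V}c(v)x(v)$.
   Context: For a vertex $v$, $\Gamma(v)$ is the set of neighbors of $v$ and $\Gamma^+(v)=\Gamma(v)\cup\{v\}$. A set $D\subseteq V$ is a dominating set if every vertex outside $D$ has a neighbor in $D$. The LP $\mathrm{DS\text{-}LP}(G,c)$ is: minimize $\sum_{v\in V}c(v)x(v)$ subject to $\sum_{u\in\Gamma^+(v)}x(u)\ge1$ for all $v\in V$ and $x(v)\ge0$ for all $v\in V$. A family of graphs is minor-closed if it is closed under taking minors; it is proper if it does not contain all graphs (equivalently, it excludes some fixed graph $H$ as a minor). *)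

(* Defs.v *)
From HB Require Import structures.
From Corelib Require Import BinNums.
From mathcomp Require Import classical_sets reals.
From mathcomp Require Import all_boot all_order all_algebra.

Set Implicit Arguments.
Unset Strict Implicit.
Unset Printing Implicit Defensive.
Import Order.TTheory GRing.Theory Num.Theory.
Local Open Scope ring_scope.

(** * Graphs and minors *)

Record sgraph := SGraph {
  vertex :> finType;
  adj : rel vertex;
  adj_sym : symmetric adj;
  adj_irr : irreflexive adj }.

Definition nbh (G : sgraph) (v : G) : {set G} := [set u | adj v u].

Definition closed_nbh (G : sgraph) (v : G) : {set G} := v |: nbh v.

Definition connected_set (G : sgraph) (A : {set G}) : Prop :=
  {in A &, forall u v : G,
    connect [rel x y | [&& x \in A, y \in A & adj x y]] u v}.

(* [H] is a minor of [G], where [B x] is the set of vertices contracted to [x];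
   in particular every graph isomorphic to [G] is a minor of [G]. *)
Definition minor (H G : sgraph) : Prop :=
  exists B : H -> {set G},
    [/\ forall x, B x != set0,
        forall x, connected_set (B x),
        forall x y, x != y -> [disjoint B x & B y]
      & forall x y, adj x y ->
          exists u v, [/\ u \in B x, v \in B y & adj u v]].

Definition minor_closed (F : sgraph -> Prop) : Prop :=
  forall G H : sgraph, F G -> minor H G -> F H.

Definition proper_family (F : sgraph -> Prop) : Prop :=
  exists H : sgraph, ~ F H.

(** * Dominating sets and their linear relaxation *)

Definition dominating (G : sgraph) (D : {set G}) : bool :=
  [forall v, (v \notin D) ==> [exists u, (u \in nbh v) && (u \in D)]].

Definition set_cost (K : numDomainType) (G : sgraph) (c : G -> K)
  (D : {set G}) : K := \sum_(v in D) c v.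

(* The default value is harmless, since [setT] is dominating. *)
Definition min_ds_cost (R : realType) (G : sgraph) (c : G -> R) : R :=
  \big[Num.min/set_cost c setT]_(D : {set G} | dominating D) set_cost c D.

Definition ds_lp_feasible (K : numDomainType) (G : sgraph) (x : G -> K) :
    Prop :=
  (forall v, 1 <= \sum_(u in closed_nbh v) x u) /\ (forall v, 0 <= x v).

Definition ds_lp_cost (K : numDomainType) (G : sgraph) (c x : G -> K) : K :=
  \sum_v c v * x v.

Definition ds_lp_opt (R : realType) (G : sgraph) (c : G -> R) : R :=
  inf [set ds_lp_cost c x | x in [set x | ds_lp_feasible x]]%classic.

(** * Polynomial time *)

(* The machine model is the WHILE language over binary trees (N. D. Jones,
   Computability and Complexity from a Programming Perspective): a fixed
   program manipulates finitely many variables by means of [Node], [hd], [tl]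
   and tests against [Leaf], each at unit cost.  Polynomial time in this model
   coincides with polynomial time on Turing machines. *)

Inductive tree := Leaf | Node of tree & tree.

Fixpoint tree_size (t : tree) : nat :=
  if t is Node l r then (tree_size l + tree_size r).+1 else 1%N.

Definition hd (t : tree) : tree := if t is Node l _ then l else Leaf.
Definition tl (t : tree) : tree := if t is Node _ r then r else Leaf.
Definition is_node (t : tree) : bool := if t is Node _ _ then true else false.

Inductive expr :=
  | EVar of nat
  | ELeaf
  | ENode of expr & expr
  | EHd of expr
  | ETl of expr.

Inductive cmd :=
  | CSkip
  | CAssign of nat & expr
  | CSeq of cmd & cmd
  | CIf of expr & cmd & cmd
  | CWhile of expr & cmd.

Definition store := nat -> tree.

Definition upd (s : store) (i : nat) (t : tree) : store :=
  fun j => if j == i then t else s j.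

Fixpoint eval (e : expr) (s : store) : tree :=
  match e with
  | EVar i => s i
  | ELeaf => Leaf
  | ENode e1 e2 => Node (eval e1 s) (eval e2 s)
  | EHd e1 => hd (eval e1 s)
  | ETl e1 => tl (eval e1 s)
  end.

Fixpoint eval_time (e : expr) : nat :=
  match e with
  | EVar _ | ELeaf => 1
  | ENode e1 e2 => (eval_time e1 + eval_time e2).+1
  | EHd e1 | ETl e1 => (eval_time e1).+1
  end.

(* [exec p s n s']: started in store [s], the command [p] terminates in
   store [s'] after [n] time units. *)
Inductive exec : cmd -> store -> nat -> store -> Prop :=
  | exec_skip s : exec CSkip s 1 s
  | exec_assign i e s :
      exec (CAssign i e) s (eval_time e).+1 (upd s i (eval e s))
  | exec_seq p q s s' s'' m n :
      exec p s m s' -> exec q s' n s'' -> exec (CSeq p q) s (m + n).+1 s''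
  | exec_if_true e p q s s' n :
      is_node (eval e s) -> exec p s n s' ->
      exec (CIf e p q) s (eval_time e + n).+1 s'
  | exec_if_false e p q s s' n :
      ~~ is_node (eval e s) -> exec q s n s' ->
      exec (CIf e p q) s (eval_time e + n).+1 s'
  | exec_while_true e p s s' s'' m n :
      is_node (eval e s) -> exec p s m s' -> exec (CWhile e p) s' n s'' ->
      exec (CWhile e p) s (eval_time e + m + n).+1 s''
  | exec_while_false e p s :
      ~~ is_node (eval e s) -> exec (CWhile e p) s (eval_time e).+1 s.

(* Input and output are both passed through variable 0. *)
Definition outputs_in_time (p : cmd) (inp : tree) (n : nat) (out : tree) :
    Prop :=
  exists s : store, exec p (upd (fun=> Leaf) 0 inp) n s /\ s 0%N = out.

(* Some program maps, in time polynomial in the size of its input, every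
   instance [i] satisfying the promise [pre] to an output [o] with
   [post i o]. *)
Definition poly_time_solvable (I : Type) (O : I -> Type)
    (encI : I -> tree) (encO : forall i, O i -> tree)
    (pre : I -> Prop) (post : forall i, O i -> Prop) : Prop :=
  exists (p : cmd) (k : nat), forall i : I, pre i ->
    exists (o : O i) (n : nat),
      [/\ outputs_in_time p (encI i) n (encO i o),
          (n <= k * tree_size (encI i) ^ k + k)%N
        & post i o].

(** * Encodings *)

Definition enc_bool (b : bool) : tree := if b then Node Leaf Leaf else Leaf.

Definition enc_seq (T : Type) (enc : T -> tree) (s : seq T) : tree :=
  foldr (fun a t => Node (enc a) t) Leaf s.

(* Binary notation, least significant bit first. *)
Fixpoint pos_bits (p : positive) : seq bool :=
  match p with
  | xH => [:: true]
  | xO q => false :: pos_bits q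
  | xI q => true :: pos_bits q
  end.

Definition nat_bits (n : nat) : seq bool :=
  if bin_of_nat n is Npos p then pos_bits p else [::].

Definition enc_nat (n : nat) : tree := enc_seq enc_bool (nat_bits n).

(* Numerator and denominator in lowest terms; the sign is dropped, so this is
   only meant for nonnegative rationals. *)
Definition enc_rat (q : rat) : tree :=
  Node (enc_nat `|numq q|%N) (enc_nat `|denq q|%N).

Record ds_instance := DSInstance {
  ds_graph : sgraph;
  ds_cost : ds_graph -> rat;
  ds_sol : ds_graph -> rat }.

(* Adjacency matrix, cost vector and fractional solution, with vertices listed
   in the order of [enum]. *)
Definition enc_ds_instance (i : ds_instance) : tree :=
  let V := enum (ds_graph i) in
  Node (enc_seq (fun u => enc_seq (fun v => enc_bool (adj u v)) V) V)
       (Node (enc_seq (fun v => enc_rat (ds_cost v)) V)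
             (enc_seq (fun v => enc_rat (ds_sol v)) V)).

Definition enc_vertex_set (G : sgraph) (D : {set G}) : tree :=
  enc_seq (fun v => enc_bool (v \in D)) (enum G).

(* Main.v *)
Require Import Defs.
From mathcomp Require Import classical_sets reals.
From mathcomp Require Import all_boot all_order all_algebra.
From mathcomp Require Import zify ring lra.
Import Order.TTheory GRing.Theory Num.Theory.

Set Implicit Arguments.
Unset Strict Implicit.
Unset Printing Implicit Defensive.

(** A proper minor-closed family excludes a complete minor, so by Mader's
    theorem its members can be oriented with out-degrees bounded by a constant
    [d].  Fix [kappa >= 2 d + 1] and give every vertex [v] the budget
    [kappa * c v].  Process the vertices [u] one by one: let [y u] be the
    smallest cost or remaining budget in the closed neighbourhood of [u],
    subtract [y u] from all budgets there, and choose a vertex attaining the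
    minimum.  The chosen vertices dominate.  A vertex chosen for its cost is
    paid for by [y u].  A vertex [v] whose budget is exhausted received at most
    [d * c v] from its out-neighbours, hence at least [(d + 1) * c v] from itself
    and its in-neighbours, and each [y u] is charged at most [d + 1] times in
    this way.  So the chosen set costs at most [2 * \sum_u y u], and [y / kappa]
    is a feasible solution of the dual linear program.

    The algorithm runs this procedure on costs rounded to powers of two, which
    makes the input fractions integral without any multiplication; it needs only
    the comparison and subtraction of binary numbers.  Its running time is
    bounded through the closure properties of a class of polynomial-time
    functions on trees. *)

(** * Clique minors in dense graphs *)

Section CompleteMinors.
Variable T : finType.
Implicit Types (e : rel T) (A B : {set T}).

Definition conn_in e A : Prop :=
  {in A &, forall u v, connect [rel x y | [&& x \in A, y \in A & e x y]] u v}.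

Definition clique_model e A (t : nat) : Prop :=
  exists B : nat -> {set T},
    (forall i, i < t -> [/\ B i != set0, B i \subset A & conn_in e (B i)]) /\
    (forall i j, i < t -> j < t -> i != j ->
       [disjoint B i & B j] /\
       exists u v, [/\ u \in B i, v \in B j & e u v]).

Definition nbh_in e A (x : T) : {set T} := [set y in A | e x y].

Definition degree_sum e A : nat := \sum_(x in A) #|nbh_in e A x|.

(** The vertex type stays [T]: [u] takes over the neighbours of [v], and [v] is discarded by passing
    to [A :\ v]. *)
Definition contract e (u v : T) : rel T := [rel x y |
  (x != y) && [|| e x y, (x == u) && e v y | (y == u) && e x v]].

Lemma contract_sym e u v : symmetric e -> symmetric (contract e u v).
Proof.
move=> es x y; rewrite /contract /= eq_sym (es x y) (es v y) (es x v).
by rewrite (orbC (_ && e y v)).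
Qed.

Lemma contract_irr e u v : irreflexive (contract e u v).
Proof. by move=> x; rewrite /contract /= eqxx. Qed.

(** Contracting [uv] destroys this edge and merges two edges at each common neighbour; every
    destroyed edge counts twice in the degree sum. *)
Lemma degree_sum_contract e A u v :
  symmetric e -> irreflexive e -> u \in A -> v \in A -> e u v ->
  degree_sum e A <= degree_sum (contract e u v) (A :\ v)
                    + (#|nbh_in e A u :&: nbh_in e A v|).*2 + 2.
Proof.
move=> es ei uA vA euv.
have neq_uv : u != v by apply: contraTneq euv => ->; rewrite ei.
set C := nbh_in e A u :&: nbh_in e A v.
have uAv : u \in A :\ v by rewrite !inE neq_uv.
rewrite /degree_sum (big_setD1 v vA) /= (big_setD1 u uAv) /=.
rewrite [X in _ <= X + _ + _](big_setD1 u uAv) /=.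
set S := \sum_(_ in _ ) _; set S' := \sum_(_ in _) _.
(* Away from [u] and [v] only common neighbours lose degree, at most one each. *)
have hS : S <= S' + #|C|.
  rewrite /S' /S -sum1_card big_mkcond /= [X in _ + X]big_mkcond /=.
  rewrite [X in X + _]big_mkcond -big_split /=; apply: leq_sum => x _.
  case: ifP => // /[!inE] /and3P[xu xv xA].
  rewrite xA /= (es u x) (es v x).
  have [xv1|xv0] := boolP (e x v); last first.
    rewrite andbF addn0; apply/subset_leq_card/fintype.subsetP => y.
    rewrite !inE /= => /andP[-> exy]; rewrite /contract /= exy orTb !andbT.
    apply/andP; split; first by apply: contraNneq xv0 => <-.
    by apply: contraTneq exy => ->; rewrite ei.
  have [xu1|xu0] := boolP (e x u).
    rewrite -[X in _ <= _ + X](cards1 v).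
    apply: leq_trans (leq_card_setU _ _).
    apply/subset_leq_card/fintype.subsetP => y.
    rewrite !inE /= => /andP[-> exy]; rewrite /contract /= exy orTb !andbT.
    case: (y == v); rewrite ?orbT //= orbF.
    by apply: contraTneq exy => ->; rewrite ei.
  rewrite addn0 (cardsD1 v) [X in _ <= X](cardsD1 u) !inE vA uA xv1 /=.
  rewrite /contract /= eqxx xu neq_uv xv1 !orbT ltnS.
  apply/subset_leq_card/fintype.subsetP => y.
  rewrite !inE /= => /and3P[-> -> exy]; rewrite /contract /= exy orTb !andbT.
  apply/andP; split; first by apply: contraNneq xu0 => <-.
  by apply: contraTneq exy => ->; rewrite ei.
(* The new neighbourhood of [u] is the union of the two old ones without [u] and [v], whence the
   2. *)
have hU : #|nbh_in e A v| + #|nbh_in e A u| <=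
          #|nbh_in (contract e u v) (A :\ v) u| + #|C| + 2.
  rewrite -cardsUI setUC setIC.
  suff: #|nbh_in e A u :|: nbh_in e A v| <= #|nbh_in (contract e u v) (A :\ v) u| + 2.
    rewrite -/C; lia.
  have -> : 2 = #|[set u; v]| by rewrite cards2 neq_uv.
  apply: leq_trans (leq_card_setU _ _).
  apply/subset_leq_card/fintype.subsetP => y; rewrite !inE /contract /= eqxx /=.
  rewrite (eq_sym u y); case: (y == u); case: (y == v) => //=; rewrite ?orbT //.
  by case: (y \in A); case: (e u y); case: (e v y).
lia.
Qed.

(** An edge of the contraction is an edge of [e] or lifts to a path of length two through [v]. *)
Lemma conn_in_uncontract e u v B :
  symmetric e -> e u v -> v \notin B -> conn_in (contract e u v) B ->
  conn_in e (if u \in B then v |: B else B).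
Proof.
move=> es euv vB hB; have [uB|uB] := boolP (u \in B); last first.
  move=> x y xB yB; apply: connect_sub (hB x y xB yB) => a b /=.
  move=> /and4P[aB bB _ /or3P[eab|/andP[/eqP ua _]|/andP[/eqP ub _]]].
  - by apply: connect1; rewrite /= aB bB.
  - by rewrite -ua aB in uB.
  - by rewrite -ub bB in uB.
pose r := [rel x y | [&& x \in v |: B, y \in v |: B & e x y]].
have r_sym : symmetric r.
  by move=> a b; rewrite /r /= (es a b) andbCA.
have csym := sym_connect_sym r_sym.
have ruv : r u v by rewrite /r /= !inE eqxx uB orbT.
have inB a b : a \in B -> b \in B -> connect r a b.
  move=> aB bB; apply: connect_sub (hB a b aB bB) => x y /=.
  move=> /and4P[xB yB _ /or3P[exy|/andP[/eqP-> evy]|/andP[/eqP-> exv]]].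
  - by apply: connect1; rewrite /r /= !inE xB yB !orbT.
  - apply: (@connect_trans _ r v); first exact: connect1.
    by apply: connect1; rewrite /r /= !inE yB eqxx orbT.
  - apply: (@connect_trans _ r v).
      by apply: connect1; rewrite /r /= !inE xB eqxx orbT.
    by rewrite csym; apply: connect1.
have tou a : a \in v |: B -> connect r a u.
  rewrite !inE => /orP[/eqP->|aB]; last exact: inB.
  by rewrite csym; apply: connect1.
move=> a b aB bB; apply: (@connect_trans _ r u); first exact: tou.
by rewrite csym; apply: tou.
Qed.

(** The branch set containing [u], if any, absorbs [v]; the edges that the contraction added at [u]
    then come from edges at [v]. *)
Lemma clique_model_uncontract e A u v t :
  symmetric e -> v \in A -> e u v ->
  clique_model (contract e u v) (A :\ v) t -> clique_model e A t.
Proof.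
move=> es vA euv [B [hB hBB]].
pose B' i := if u \in B i then v |: B i else B i.
have vB i : i < t -> v \notin B i.
  move=> it; have [_ /fintype.subsetP BA _] := hB i it.
  by apply/negP => /BA; rewrite !inE eqxx.
have subB i : B i \subset B' i.
  by rewrite /B'; case: ifP => // _; apply: subsetUr.
exists B'; split=> [i it|i j it jt ij].
  have [B0 BA Bc] := hB i it; split.
  - apply: contraNneq B0 => B'0; rewrite -subset0 -B'0; exact: subB.
  - have BA' : B i \subset A by apply: subset_trans BA (subsetDl _ _).
    by rewrite /B'; case: ifP => // _; rewrite subUset sub1set vA.
  - exact: conn_in_uncontract (vB i it) Bc.
have [dis [x [y [xB yB exy]]]] := hBB i j it jt ij; split.
  rewrite /B'; case: ifP => ui; case: ifP => uj //.
  - by rewrite (disjointFr dis ui) in uj.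
  - by rewrite disjoint_sym -setI_eq0 setIUr setU_eq0 !setI_eq0 disjoint_sym
      disjoints1 vB //= disjoint_sym.
  - by rewrite -setI_eq0 setIUr setU_eq0 !setI_eq0 disjoint_sym
      disjoints1 vB.
have xB' := fintype.subsetP (subB i) x xB.
have yB' := fintype.subsetP (subB j) y yB.
move: exy => /andP[_ /or3P[exy|/andP[/eqP xu evy]|/andP[/eqP yu exv]]].
- by exists x, y.
- by exists v, y; split=> //; rewrite /B' -xu xB !inE eqxx.
- by exists x, v; split=> //; rewrite /B' -yu yB !inE eqxx.
Qed.

(* Mader's theorem.  An edge with few common neighbours is contracted; if there
   is none, the neighbourhood of any vertex is dense enough to induct on [t]. *)
Theorem dense_clique_model t e A :
  symmetric e -> irreflexive e -> A != set0 ->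
  2 ^ t * #|A| <= degree_sum e A -> clique_model e A t.
Proof.
elim: t e A => [|t IHt] e A es ei A0 hd; first by exists (fun=> set0).
move: {2}#|A| (leqnn #|A|) => n; elim: n e A es ei A0 hd => [|n IHn] e A es ei A0 hd hn.
  by move: A0; rewrite -cards_eq0; move: hn; case: #|A|.
case: (boolP [exists u in A, exists v in A,
    e u v && (#|nbh_in e A u :&: nbh_in e A v| < 2 ^ t)]).
  move=> /existsP[u /andP[uA /existsP[v /and3P[vA euv codeg]]]].
  have neq_uv : u != v by apply: contraTneq euv => ->; rewrite ei.
  apply: (clique_model_uncontract es vA euv); apply: IHn.
  - exact: contract_sym.
  - exact: contract_irr.
  - by apply/set0Pn; exists u; rewrite !inE neq_uv.
  (* With fewer than [2 ^ t] common neighbours the loss is at most [2 * (2 ^ t - 1) + 2 = 2 ^ t.+1],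
     which is what having one vertex fewer allows. *)
  - have := degree_sum_contract es ei uA vA euv.
    have := cardsD1 v A; rewrite vA; move: hd codeg; rewrite expnS => ? ? ?.
    nia.
  - by have := cardsD1 v A; rewrite vA; lia.
rewrite negb_exists_in => /forallP hcodeg.
have [x xA [y yA exy]] : exists2 x, x \in A & exists2 y, y \in A & e x y.
  have : 0 < degree_sum e A.
    by apply: leq_trans hd; rewrite muln_gt0 expn_gt0 /= card_gt0.
  rewrite lt0n sum_nat_eq0 => /forallPn[x]; rewrite negb_imply => /andP[xA].
  by rewrite cards_eq0 => /set0Pn[y] /[!inE] /andP[yA exy]; exists x => //; exists y.
(* Each neighbour of [x] has at least [2 ^ t] neighbours in common with [x], so the graph on the
   neighbourhood has minimum degree at least [2 ^ t]. The singleton of [x] becomes the last branch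
   set. *)
have [| |B [hB hBB]] := IHt e (nbh_in e A x) es ei.
- by apply/set0Pn; exists y; rewrite inE yA.
- rewrite mulnC -sum_nat_const; apply: leq_sum => z /[!inE] /andP[zA exz].
  have := hcodeg x; rewrite xA negb_exists_in => /forallP/(_ z).
  rewrite zA exz -leqNgt /= => /leq_trans; apply.
  by apply/subset_leq_card/fintype.subsetP => a; rewrite !inE => /andP[-> /andP[_ ->]].
have xB i : i < t -> x \notin B i.
  move=> it; have [_ /fintype.subsetP BA _] := hB i it.
  by apply/negP => /BA; rewrite !inE ei andbF.
have adjx i : i < t -> exists2 z, z \in B i & e x z.
  move=> it; have [/set0Pn[z zB] /fintype.subsetP BA _] := hB i it.
  by exists z => //; have := BA z zB; rewrite inE => /andP[].
exists (fun i => if i == t then [set x] else B i); split=> [i|i j].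
  rewrite ltnS leq_eqVlt; case: eqP => [_ _|_ /= it].
    split; first by apply/set0Pn; exists x; rewrite inE.
      by rewrite sub1set.
    by move=> a b /set1P-> /set1P->.
  have [? Bx ?] := hB i it; split=> //.
  by apply: subset_trans Bx _; apply/fintype.subsetP => a /[!inE] /andP[].
rewrite !ltnS (leq_eqVlt i) (leq_eqVlt j).
case: eqP => [-> _|_ /= it]; case: eqP => [->|_ /= jt] //; first by rewrite eqxx.
- move=> _; rewrite disjoints1 xB //; split=> //.
  by have [z zB exz] := adjx j jt; exists x, z; rewrite inE eqxx.
- move=> _ _; rewrite disjoint_sym disjoints1 xB //; split=> //.
  by have [z zB exz] := adjx i it; exists z, x; rewrite inE eqxx es.
- by move=> ij; apply: hBB.
Qed.

(** By averaging, some vertex has degree below [d]; its edges are directed away from it and the rest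
    is oriented by induction. *)
Lemma orientation_of_sparse e (d : nat) :
  symmetric e ->
  (forall A, A != set0 -> degree_sum e A < d * #|A|) ->
  exists o : rel T,
    (forall u v, e u v -> o u v || o v u) /\
    (forall u, #|[set v | o u v]| <= d).
Proof.
move=> es sparse.
suff [o [oe od]] : exists o : rel T,
    (forall u v, u \in [set: T] -> v \in [set: T] -> e u v -> o u v || o v u) /\
    (forall u, #|[set v | o u v]| <= d).
  by exists o; split=> // u v; apply: oe; rewrite inE.
move: [set: T] => A; move: {2}#|A| (leqnn #|A|) => n.
elim: n A => [|n IHn] A hn.
  exists [rel _ _ | false]; split=> [u v uA|u].
    by move: hn; rewrite leqn0 cards_eq0 => /eqP A0; rewrite A0 inE in uA.
  by rewrite eq_card0 // => v; rewrite inE.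
have [->|A0] := eqVneq A set0; first by apply: IHn; rewrite cards0.
have [v vA dv] : exists2 v, v \in A & #|nbh_in e A v| < d.
  apply/exists_inP; apply: contraLR (sparse A A0); rewrite negb_exists_in -leqNgt.
  move=> /forall_inP h; rewrite mulnC -sum_nat_const; apply: leq_sum => x xA.
  by rewrite leqNgt h.
have [|o [oe od]] := IHn (A :\ v); first by have := cardsD1 v A; rewrite vA; lia.
exists [rel x y | if x == v then y \in nbh_in e A v else o x y]; split.
  move=> x y xA yA exy /=.
  have [xv|xv] := eqVneq x v; first by rewrite inE yA -xv exy.
  have [yv|yv] := eqVneq y v; first by rewrite inE xA -yv es exy orbT.
  by apply: oe; rewrite // !inE ?xv ?yv.
move=> u; have [uv|uv] := eqVneq u v; last first.
  by rewrite (eq_card (B := [set y | o u y])) // => y; rewrite !inE /= (negbTE uv).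
apply: ltnW; apply: leq_ltn_trans dv; apply/subset_leq_card/fintype.subsetP => y.
by rewrite !inE /= uv eqxx inE.
Qed.

End CompleteMinors.

(** * Orientations from an excluded minor *)

Definition complete_graph (T : finType) : sgraph.
Proof.
by refine (@SGraph T [rel x y | x != y] _ _) => [x y|x] /=; rewrite ?eqxx // eq_sym.
Defined.

Lemma minor_complete_graph (H : sgraph) : minor H (complete_graph H).
Proof.
exists (fun x => [set x]); split=> [x|x|x y xy|x y xy].
- by apply/set0Pn; exists x; rewrite inE.
- by move=> a b /set1P-> /set1P->.
- by rewrite disjoints1 inE.
- exists x, y; rewrite !inE; split=> //=.
  by apply: contraTneq xy => ->; rewrite adj_irr.
Qed.

Lemma minor_of_clique_model (G : sgraph) (T : finType) :
  clique_model (@adj G) setT #|T| -> minor (complete_graph T) G.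
Proof.
move=> [B [hB hBB]].
exists (fun x : T => B (enum_rank x)); split=> [x|x|x y xy|x y xy];
  try by have [] := hB (enum_rank x) (ltn_ord _).
all: have xy' : nat_of_ord (enum_rank x) != enum_rank y
  by apply: contraNneq xy => /ord_inj/enum_rank_inj->.
all: by have [] := hBB _ _ (ltn_ord (enum_rank x)) (ltn_ord (enum_rank y)) xy'.
Qed.

(** A graph [H] outside the family is a minor of the complete graph on its vertices, which is
    therefore excluded as well; Mader's theorem then bounds all degree sums. *)
Lemma minor_closed_orientation (F : sgraph -> Prop) :
  minor_closed F -> proper_family F ->
  exists d : nat, forall G, F G -> exists o : rel G,
    (forall u v, adj u v -> o u v || o v u) /\
    (forall u, #|[set v | o u v]| <= d).
Proof.
move=> cl [H nFH]; exists (2 ^ #|H|) => G FG.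
apply: orientation_of_sparse (@adj_sym G) _ => A A0.
rewrite ltnNge; apply/negP => /(dense_clique_model (@adj_sym G) (@adj_irr G) A0).
move=> [B [hB hBB]]; apply: nFH; apply: (cl (complete_graph H)) (minor_complete_graph H).
apply: (cl _ _ FG); apply: minor_of_clique_model; exists B; split=> // i it.
by have [? _ ?] := hB i it; split=> //; apply: finset.subsetT.
Qed.

(** * Polynomial-time functions on trees *)

Lemma tree_size_gt0 t : 0 < tree_size t. Proof. by case: t. Qed.

Lemma tree_size_hd t : tree_size (hd t) <= tree_size t.
Proof. by case: t => //= l r; lia. Qed.

Lemma tree_size_tl t : tree_size (tl t) <= tree_size t.
Proof. by case: t => //= l r; lia. Qed.

(** Since the base is at least 2 for every [n], constant factors and summands are absorbed by the
    exponent. *)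
Definition poly_bounded (b : nat -> nat) : Prop :=
  exists k, forall n, b n <= (n + 2) ^ k.

Lemma poly_bounded_id : poly_bounded id.
Proof. by exists 1 => n; lia. Qed.

Lemma poly_bounded_const c : poly_bounded (fun=> c).
Proof.
exists c => n; apply: leq_trans (ltnW (ltn_expl c (isT : 1 < 2))) _.
by case: c => // c; rewrite leq_exp2r //; lia.
Qed.

Lemma poly_bounded_mul a b :
  poly_bounded a -> poly_bounded b -> poly_bounded (fun n => a n * b n).
Proof.
by move=> [k hk] [l hl]; exists (k + l) => n; rewrite expnD leq_mul.
Qed.

Lemma poly_bounded_add a b :
  poly_bounded a -> poly_bounded b -> poly_bounded (fun n => a n + b n).
Proof.
move=> [k hk] [l hl]; exists (k + l).+1 => n.
have hA := hk n; have hB := hl n.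
have : 0 < (n + 2) ^ k by rewrite expn_gt0; lia.
have : 0 < (n + 2) ^ l by rewrite expn_gt0; lia.
rewrite expnS expnD; nia.
Qed.

Lemma poly_bounded_comp a b :
  poly_bounded a -> poly_bounded b -> poly_bounded (fun n => a (b n)).
Proof.
move=> [k hk] [l hl]; exists (l.+2 * k) => n.
apply: leq_trans (hk _) _; rewrite expnM; case: k {hk} => // k.
rewrite leq_exp2r //; apply: leq_trans (_ : (n + 2) ^ l + 2 <= _).
  by rewrite leq_add2r.
have : 0 < (n + 2) ^ l by rewrite expn_gt0; lia.
rewrite !expnS; nia.
Qed.

Lemma poly_bounded_mono b :
  poly_bounded b -> exists2 b', poly_bounded b' &
    (forall n, b n <= b' n) /\ {homo b' : m n / m <= n}.
Proof.
move=> [k hk]; exists (fun n => (n + 2) ^ k); first by exists k.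
split=> // m n mn; case: k {hk} => // k; rewrite leq_exp2r //; lia.
Qed.

(* Registers from [m] on are left untouched and the other ones may contain
   anything at the start, so that programs can be chained.  The size bound has
   to be part of the definition: repeated squaring [x := Node x x] builds trees
   of exponential size in linear time. *)
Definition ptime (f : tree -> tree) : Prop :=
  exists (p : cmd) (m : nat) (b : nat -> nat),
    [/\ poly_bounded b, {homo b : i j / i <= j} &
     forall s, exists n s',
       [/\ exec p s n s', s' 0 = f (s 0), forall j, m <= j -> s' j = s j,
           n <= b (tree_size (s 0)) & tree_size (f (s 0)) <= b (tree_size (s 0))]].

Lemma ptime_intro f p m (b : nat -> nat) :
  poly_bounded b ->
  (forall s, exists n s',
       [/\ exec p s n s', s' 0 = f (s 0), forall j, m <= j -> s' j = s j,
           n <= b (tree_size (s 0)) & tree_size (f (s 0)) <= b (tree_size (s 0))]) ->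
  ptime f.
Proof.
move=> /poly_bounded_mono[b' pb' [bb' mb']] hp; exists p, m, b'; split=> // s.
have [n [s' [? ? ? ? ?]]] := hp s; exists n, s'; split=> //.
  exact: leq_trans (bb' _).
exact: leq_trans (bb' _).
Qed.

Lemma upd_same s i t : upd s i t i = t. Proof. by rewrite /upd eqxx. Qed.

Lemma upd_other s i j t : j != i -> upd s i t j = s j.
Proof. by rewrite /upd => /negbTE->. Qed.

Lemma ptime_eq f g : f =1 g -> ptime f -> ptime g.
Proof.
move=> fg [p [m [b [pb mb hp]]]]; exists p, m, b; split=> // s.
by have := hp s; rewrite fg.
Qed.

Lemma ptime_id : ptime (fun t => t).
Proof.
apply: (@ptime_intro _ CSkip 0 (fun n => n + 1)).
  exact: poly_bounded_add poly_bounded_id (poly_bounded_const 1).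
by move=> s; exists 1, s; split; rewrite ?leq_addl ?leq_addr //; apply: exec_skip.
Qed.

Lemma ptime_comp g f : ptime g -> ptime f -> ptime (fun t => g (f t)).
Proof.
move=> [q [mq [bq [pbq mbq hq]]]] [p [mp [bp [pbp mbp hp]]]].
apply: (@ptime_intro _ (CSeq p q) (mp + mq) (fun n => bp n + bq (bp n) + 1)).
  apply: poly_bounded_add (poly_bounded_const 1).
  by apply: poly_bounded_add => //; apply: poly_bounded_comp.
move=> s; have [n [s1 [e1 s10 pres1 t1 z1]]] := hp s.
have [n' [s2 [e2 s20 pres2 t2 z2]]] := hq s1.
have lem := mbq _ _ z1.
exists (n + n').+1, s2; split.
- exact: exec_seq e1 e2.
- by rewrite s20 s10.
- by move=> j hj; rewrite pres2 ?pres1 //; lia.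
- by move: t2; rewrite s10; lia.
- by move: z2; rewrite s10; lia.
Qed.

Lemma ptime_leaf : ptime (fun=> Leaf).
Proof.
apply: (@ptime_intro _ (CAssign 0 ELeaf) 1 (fun n => 2)).
  exact: poly_bounded_const.
move=> s; exists 2, (upd s 0 Leaf); split=> //; first exact: (exec_assign 0 ELeaf).
by move=> j hj; rewrite upd_other //; lia.
Qed.

Lemma ptime_hd : ptime hd.
Proof.
apply: (@ptime_intro _ (CAssign 0 (EHd (EVar 0))) 1 (fun n => n + 3)).
  exact: poly_bounded_add poly_bounded_id (poly_bounded_const 3).
move=> s; exists 3, (upd s 0 (hd (s 0))); split=> //.
- exact: (exec_assign 0 (EHd (EVar 0))).
- by move=> j hj; rewrite upd_other //; lia.
- by rewrite leq_addl.
- by have := tree_size_hd (s 0); lia.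
Qed.

Lemma ptime_tl : ptime tl.
Proof.
apply: (@ptime_intro _ (CAssign 0 (ETl (EVar 0))) 1 (fun n => n + 3)).
  exact: poly_bounded_add poly_bounded_id (poly_bounded_const 3).
move=> s; exists 3, (upd s 0 (tl (s 0))); split=> //.
- exact: (exec_assign 0 (ETl (EVar 0))).
- by move=> j hj; rewrite upd_other //; lia.
- by rewrite leq_addl.
- by have := tree_size_tl (s 0); lia.
Qed.

Lemma ptime_node f g : ptime f -> ptime g -> ptime (fun t => Node (f t) (g t)).
Proof.
move=> [p [mp [bp [pbp mbp hp]]]] [q [mq [bq [pbq mbq hq]]]].
(* Neither program touches the registers [m] and [m.+1]: the first keeps the input, the second the
   value of [f]. *)
pose m := (mp + mq).+1.
apply: (@ptime_intro _
  (CSeq (CAssign m (EVar 0)) (CSeq p (CSeq (CAssign m.+1 (EVar 0))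
    (CSeq (CAssign 0 (EVar m)) (CSeq q
    (CAssign 0 (ENode (EVar m.+1) (EVar 0)))))))) m.+2
  (fun n => bp n + bq n + 15)).
  apply: poly_bounded_add (poly_bounded_const _).
  exact: poly_bounded_add.
move=> s.
pose s1 := upd s m (s 0).
have s10 : s1 0 = s 0 by rewrite /s1 upd_other.
have [n [s2 [e2 s20 pres2 t2 z2]]] := hp s1.
pose s3 := upd s2 m.+1 (s2 0).
pose s4 := upd s3 0 (s3 m).
have s40 : s4 0 = s 0.
  rewrite /s4 upd_same /s3 upd_other; last by lia.
  by rewrite pres2 /s1 ?upd_same //; lia.
have [n' [s5 [e5 s50 pres5 t5 z5]]] := hq s4.
pose s6 := upd s5 0 (Node (s5 m.+1) (s5 0)).
have s5m : s5 m.+1 = f (s 0).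
  by rewrite pres5 /s4 ?upd_other /s3 ?upd_same ?s20 ?s10 //; lia.
exists (2 + (n + (2 + (2 + (n' + 4).+1).+1).+1).+1).+1, s6; split.
- apply: exec_seq (exec_assign m (EVar 0) s) _.
  apply: exec_seq e2 _.
  apply: exec_seq (exec_assign m.+1 (EVar 0) s2) _.
  apply: exec_seq (exec_assign 0 (EVar m) s3) _.
  apply: exec_seq e5 _.
  exact: exec_assign 0 (ENode (EVar m.+1) (EVar 0)) s5.
- by rewrite /s6 upd_same s5m s50 s40.
- move=> j hj; rewrite /s6 upd_other; last by lia.
  rewrite pres5; last by lia.
  rewrite /s4 upd_other; last by lia.
  rewrite /s3 upd_other; last by lia.
  rewrite pres2; last by lia.
  by rewrite /s1 upd_other //; lia.
- by move: t2 t5; rewrite s10 s40; lia.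
- by move: z2 z5; rewrite s10 s40 /=; lia.
Qed.

Lemma ptime_if f g h : ptime f -> ptime g -> ptime h ->
  ptime (fun t => if is_node (f t) then g t else h t).
Proof.
move=> [p [mp [bp [pbp mbp hp]]]] [q [mq [bq [pbq mbq hq]]]]
  [o [mo [bo [pbo mbo ho]]]].
pose m := (mp + mq + mo).+1.
apply: (@ptime_intro _
  (CSeq (CAssign m (EVar 0)) (CSeq p (CSeq (CAssign m.+1 (EVar 0))
    (CSeq (CAssign 0 (EVar m)) (CIf (EVar m.+1) q o))))) m.+2
  (fun n => bp n + bq n + bo n + 15)).
  apply: poly_bounded_add (poly_bounded_const _).
  by apply: poly_bounded_add => //; apply: poly_bounded_add.
move=> s.
pose s1 := upd s m (s 0).
have s10 : s1 0 = s 0 by rewrite /s1 upd_other.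
have [n [s2 [e2 s20 pres2 t2 z2]]] := hp s1.
pose s3 := upd s2 m.+1 (s2 0).
pose s4 := upd s3 0 (s3 m).
have s40 : s4 0 = s 0.
  rewrite /s4 upd_same /s3 upd_other; last by lia.
  by rewrite pres2 /s1 ?upd_same //; lia.
have s4m : s4 m.+1 = f (s 0).
  by rewrite /s4 upd_other /s3 ?upd_same ?s20 ?s10 //; lia.
have pres4 j : m.+2 <= j -> s4 j = s j.
  move=> hj; rewrite /s4 upd_other; last by lia.
  rewrite /s3 upd_other; last by lia.
  rewrite pres2; last by lia.
  by rewrite /s1 upd_other //; lia.
(* The prefix common to both branches is accounted for once. *)
have main r n' s5 : exec (CIf (EVar m.+1) q o) s4 n' s5 -> s5 0 = r ->
    (forall j, m.+1 <= j -> s5 j = s4 j) ->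
    n' <= bq (tree_size (s 0)) + bo (tree_size (s 0)) + 2 ->
    tree_size r <= bq (tree_size (s 0)) + bo (tree_size (s 0)) ->
    exists n s', [/\ exec (CSeq (CAssign m (EVar 0)) (CSeq p (CSeq (CAssign m.+1 (EVar 0))
    (CSeq (CAssign 0 (EVar m)) (CIf (EVar m.+1) q o))))) s n s',
     s' 0 = r, forall j, m.+2 <= j -> s' j = s j,
     n <= bp (tree_size (s 0)) + bq (tree_size (s 0)) + bo (tree_size (s 0)) + 15
     & tree_size r <= bp (tree_size (s 0)) + bq (tree_size (s 0)) + bo (tree_size (s 0)) + 15].
  move=> e5 s50 pres5 t5 z5.
  exists (2 + (n + (2 + (2 + n').+1).+1).+1).+1, s5; split=> //.
  - apply: exec_seq (exec_assign m (EVar 0) s) _.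
    apply: exec_seq e2 _.
    apply: exec_seq (exec_assign m.+1 (EVar 0) s2) _.
    exact: exec_seq (exec_assign 0 (EVar m) s3) _.
  - by move=> j hj; rewrite pres5 ?pres4 //; lia.
  - by move: t2; rewrite s10; lia.
  - by lia.
case: ifP => ft.
  have [n' [s5 [e5 s50 pres5 t5 z5]]] := hq s4; rewrite s40 in s50 t5 z5.
  apply: (main _ (1 + n').+1 s5) => //; [|by move=> j hj; apply: pres5; lia|by lia|by lia].
  by apply: (@exec_if_true (EVar m.+1)) => //=; rewrite s4m.
have [n' [s5 [e5 s50 pres5 t5 z5]]] := ho s4; rewrite s40 in s50 t5 z5.
apply: (main _ (1 + n').+1 s5) => //; [|by move=> j hj; apply: pres5; lia|by lia|by lia].
by apply: (@exec_if_false (EVar m.+1)) => //=; rewrite s4m ft.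
Qed.

(** * Loops over lists *)

Fixpoint tfold (f : tree -> tree) (l a : tree) : tree :=
  if l is Node x l' then tfold f l' (f (Node x a)) else a.

(** The accumulator reached after a prefix is the fold over that prefix, so the bound [b] controls
    all intermediate accumulators and thereby the time of each iteration. *)
Lemma ptime_tfold_bounded f (b : nat -> nat) : ptime f ->
  poly_bounded b ->
  (forall l a, tree_size (tfold f l a) <= b (tree_size l + tree_size a)) ->
  ptime (fun t => tfold f (hd t) (tl t)).
Proof.
move=> [p [mp [bp [pbp mbp hp]]]] /poly_bounded_mono[b' pb' [bb' mb']] hb.
pose m := mp.+1.
pose body := CSeq (CAssign 0 (ENode (EHd (EVar m)) (EVar 0)))
               (CSeq p (CAssign m (ETl (EVar m)))).
(* [N] bounds the remaining list and [M] the accumulators; register [m] holds the remaining list. *)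
have loop N M l s :
    s m = l -> tree_size l <= N ->
    (forall l1, tree_size l1 <= tree_size l -> tree_size (tfold f l1 (s 0)) <= M) ->
    exists n s', [/\ exec (CWhile (EVar m) body) s n s',
      s' 0 = tfold f l (s 0), forall j, m.+1 <= j -> s' j = s j
      & n <= tree_size l * (bp (N + M) + 13)].
  elim: l s => [|x _ l IHl] s sm lN hM.
    exists 2, s; split=> //; last by rewrite /=; lia.
    by apply: (@exec_while_false (EVar m)) => /=; rewrite sm.
  pose s1 := upd s 0 (Node x (s 0)).
  have [n1 [s2 [e2 s20 pres2 t2 z2]]] := hp s1.
  have s10 : s1 0 = Node x (s 0) by rewrite /s1 upd_same.
  rewrite s10 in s20 t2 z2.
  pose s3 := upd s2 m (tl (s2 m)).
  have s3m : s3 m = l.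
    by rewrite /s3 upd_same pres2 // /s1 upd_other // sm.
  have s30 : s3 0 = f (Node x (s 0)) by rewrite /s3 upd_other.
  have [| |n4 [s4 [e4 s40 pres4 t4]]] := IHl s3 s3m.
  - by move: lN => /=; lia.
  - by move=> l1 hl1; rewrite s30; apply: (hM (Node x l1)) => /=; lia.
  rewrite s30 in s40.
  exists (1 + (5 + (n1 + 3).+1).+1 + n4).+1, s4; split=> //.
  - apply: (@exec_while_true (EVar m) body s s3) e4; first by rewrite /= sm.
    apply: exec_seq (_ : exec _ _ 5 s1) _.
      have := exec_assign 0 (ENode (EHd (EVar m)) (EVar 0)) s.
      by rewrite /= sm.
    exact: exec_seq e2 (exec_assign m (ETl (EVar m)) s2).
  - move=> j hj; rewrite pres4 // /s3 upd_other; last by lia.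
    by rewrite pres2 /s1 ?upd_other //; lia.
  - have sM : tree_size (s 0) <= M by apply: (hM Leaf) => /=; lia.
    have : bp (tree_size (Node x (s 0))) <= bp (N + M).
      by apply: mbp; move: lN => /=; have := tree_size_gt0 l; lia.
    by move: t4 t2 => /=; nia.
have b'size t : tree_size (tfold f (hd t) (tl t)) <= b' (tree_size t + 1).
  apply: leq_trans (hb _ _) _; apply: leq_trans (bb' _) _; apply: mb'.
  by case: t => //= l r; lia.
apply: (@ptime_intro _ (CSeq (CAssign m (EHd (EVar 0)))
   (CSeq (CAssign 0 (ETl (EVar 0))) (CWhile (EVar m) body))) m.+1
   (fun n => n * (bp (n + b' (n + n)) + 13) + 10 + b' (n + 1))).
  have pid := poly_bounded_id; have pc := poly_bounded_const.
  apply: poly_bounded_add; last first.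
    by apply: poly_bounded_comp => //; apply: poly_bounded_add.
  apply: poly_bounded_add => //; apply: poly_bounded_mul => //.
  apply: poly_bounded_add => //; apply: poly_bounded_comp => //.
  apply: poly_bounded_add => //; apply: poly_bounded_comp => //.
  exact: poly_bounded_add.
move=> s; pose s1 := upd s m (hd (s 0)).
have s10 : s1 0 = s 0 by rewrite /s1 upd_other.
pose s2 := upd s1 0 (tl (s1 0)).
have s20 : s2 0 = tl (s 0) by rewrite /s2 upd_same s10.
have s2m : s2 m = hd (s 0) by rewrite /s2 upd_other // /s1 upd_same.
set N := tree_size (s 0).
have [| |n [s3 [e3 s30 pres3 t3]]] := loop N (b' (N + N)) _ _ s2m.
- exact: tree_size_hd.
- move=> l1 hl1; rewrite s20; apply: leq_trans (hb _ _) _.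
  apply: leq_trans (bb' _) _; apply: mb'; apply: leq_add (tree_size_tl _).
  exact: leq_trans hl1 (tree_size_hd _).
exists (3 + (3 + n).+1).+1, s3; split.
- apply: exec_seq (exec_assign m (EHd (EVar 0)) s) _.
  exact: exec_seq (exec_assign 0 (ETl (EVar 0)) s1) e3.
- by rewrite s30 s20.
- move=> j hj; rewrite pres3 // /s2 upd_other; last by lia.
  by rewrite /s1 upd_other //; lia.
- have : tree_size (hd (s 0)) <= N by exact: tree_size_hd.
  by move: t3 => /=; nia.
- by have := b'size (s 0); rewrite -/N; lia.
Qed.

(* [mu] is a potential that each step of the loop increases by at most a linear
   function of the size of the list element it consumes. *)
Lemma ptime_tfold f (mu : tree -> nat) C : ptime f ->
  (forall a, mu a <= C * tree_size a) ->
  (forall x a, mu (f (Node x a)) <= mu a + C * tree_size x) ->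
  (forall x a, tree_size (f (Node x a)) <= C * (mu a + tree_size x)) ->
  ptime (fun t => tfold f (hd t) (tl t)).
Proof.
move=> pf mu0 muS sizeS.
apply: (@ptime_tfold_bounded f (fun n => n + C * (C * n + n))) => //.
  have pid := poly_bounded_id; have pc := poly_bounded_const.
  apply: poly_bounded_add => //; apply: poly_bounded_mul => //.
  by apply: poly_bounded_add => //; apply: poly_bounded_mul.
(* The maximum covers the empty list, for which the accumulator is returned as it came and [mu] need
   not bound its size. *)
have aux l a : tree_size (tfold f l a) <=
    maxn (tree_size a) (C * (mu a + C * tree_size l + tree_size l)).
  elim: l a => [|x _ l IHl] a /=; first by rewrite leq_maxl.
  apply: leq_trans (IHl _) _; rewrite leq_max; apply/orP; right; rewrite geq_max.
  apply/andP; split.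
    by apply: leq_trans (sizeS x a) _; rewrite leq_mul2l; apply/orP; right; nia.
  by rewrite leq_mul2l; apply/orP; right; have := muS x a; nia.
move=> l a; apply: leq_trans (aux l a) _; have := mu0 a.
move: (mu a) (tree_size l) (tree_size a) => m sl sa h.
rewrite geq_max; apply/andP; split; first by lia.
apply: leq_trans (leq_addl _ _); rewrite leq_mul2l; apply/orP; right; nia.
Qed.

Lemma ptime_tfold_additive f C : ptime f ->
  (forall x a, tree_size (f (Node x a)) <= tree_size a + C * tree_size x) ->
  ptime (fun t => tfold f (hd t) (tl t)).
Proof.
move=> pf hf; apply: (@ptime_tfold f tree_size C.+1) => // [a|x a|x a].
- by rewrite leq_pmull.
- by have := hf x a; nia.
- by have := hf x a; nia.
Qed.

(** * Tests, and automation for closure properties *)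

Definition pcond (c : tree -> bool) : Prop := ptime (fun t => enc_bool (c t)).

Lemma ptime_cond c g h : pcond c -> ptime g -> ptime h ->
  ptime (fun t => if c t then g t else h t).
Proof.
move=> pc pg ph; apply: ptime_eq (ptime_if pc pg ph) => t.
by case: (c t).
Qed.

Lemma ptime_enc_bool b : ptime (fun=> enc_bool b).
Proof. by case: b; [apply: ptime_node|]; apply: ptime_leaf. Qed.

Lemma pcond_const b : pcond (fun=> b).
Proof. exact: ptime_enc_bool. Qed.

Lemma pcond_if c d e : pcond c -> pcond d -> pcond e ->
  pcond (fun t => if c t then d t else e t).
Proof.
move=> pc pd pe; apply: ptime_eq (ptime_cond pc pd pe) => t.
by case: (c t).
Qed.

Lemma pcond_neg c : pcond c -> pcond (fun t => ~~ c t).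
Proof. by move=> pc; exact: pcond_if pc (pcond_const _) (pcond_const _). Qed.

Lemma pcond_and c d : pcond c -> pcond d -> pcond (fun t => c t && d t).
Proof. by move=> pc pd; exact: pcond_if pc pd (pcond_const _). Qed.

Lemma pcond_or c d : pcond c -> pcond d -> pcond (fun t => c t || d t).
Proof. by move=> pc pd; exact: pcond_if pc (pcond_const _) pd. Qed.

Lemma pcond_xor c d : pcond c -> pcond d -> pcond (fun t => c t (+) d t).
Proof.
move=> pc pd; apply: ptime_eq (pcond_if pc (pcond_neg pd) pd) => t.
by case: (c t).
Qed.

Lemma pcond_is_node f : ptime f -> pcond (fun t => is_node (f t)).
Proof.
move=> pf; apply: ptime_if => //; first by apply: (ptime_enc_bool true).
exact: ptime_leaf.
Qed.

Lemma pcond_comp c f : pcond c -> ptime f -> pcond (fun t => c (f t)).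
Proof. exact: ptime_comp. Qed.

Lemma ptime_tfold_comp f g h : ptime (fun t => tfold f (hd t) (tl t)) ->
  ptime g -> ptime h -> ptime (fun t => tfold f (g t) (h t)).
Proof. by move=> pf pg ph; exact: ptime_comp pf (ptime_node pg ph). Qed.

Create HintDb ptime_db.

(** The head of the expression determines the closure lemma; programs already shown polynomial are
    found in [ptime_db]. *)
Ltac solve_ptime := repeat
  match goal with
  | |- _ => solve [auto with ptime_db nocore]
  | |- ptime (fun t => t) => exact: ptime_id
  | |- ptime (fun _ => Leaf) => exact: ptime_leaf
  | |- ptime (fun t => Node _ _) => apply: ptime_node
  | |- ptime (fun t => enc_bool _) => rewrite -/(pcond _)
  | |- ptime (fun t => if _ then _ else _) => apply: ptime_cond
  | |- ptime (fun t => tfold _ _ _) =>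
      apply: ptime_tfold_comp; first by solve [auto with ptime_db]
  | |- ptime (fun t => ?F (@?A t)) =>
      apply: (@ptime_comp F A); first by solve [auto with ptime_db]
  | |- pcond (fun t => is_node _) => apply: pcond_is_node
  | |- pcond (fun t => ~~ _) => apply: pcond_neg
  | |- pcond (fun t => _ && _) => apply: pcond_and
  | |- pcond (fun t => _ || _) => apply: pcond_or
  | |- pcond (fun t => _ (+) _) => apply: pcond_xor
  | |- pcond (fun t => if _ then _ else _) => apply: pcond_if
  | |- pcond (fun _ => true) => exact: pcond_const
  | |- pcond (fun _ => false) => exact: pcond_const
  | |- pcond (fun t => ?F (@?A t)) =>
      apply: (@pcond_comp F A); first by solve [auto with ptime_db]
  end.

#[local] Hint Resolve ptime_hd ptime_tl : ptime_db.

Lemma tree_size_enc_bool b : tree_size (enc_bool b) <= 3.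
Proof. by case: b. Qed.

(** * List programs on trees *)

Fixpoint tsum (g : tree -> nat) (l : tree) : nat :=
  if l is Node x l' then g x + tsum g l' else 0.

Lemma tree_size_tsum l : tree_size l = (tsum (fun x => (tree_size x).+1) l).+1.
Proof. by elim: l => //= x _ l ->; lia. Qed.

(** Loops accumulate their results in reverse order; this restores it. *)
Definition trev (l : tree) : tree := tfold (fun t => t) l Leaf.

Lemma ptime_trev_fold : ptime (fun t => tfold (fun t => t) (hd t) (tl t)).
Proof.
by apply: (@ptime_tfold_additive _ 2) => [|x a /=]; [solve_ptime|
  have := tree_size_gt0 x; lia].
Qed.
#[local] Hint Resolve ptime_trev_fold : ptime_db.

Lemma ptime_trev : ptime trev. Proof. by rewrite /trev; solve_ptime. Qed.
#[local] Hint Resolve ptime_trev : ptime_db.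

Lemma tsum_tfold_id g l a : tsum g (tfold (fun t => t) l a) = tsum g l + tsum g a.
Proof. by elim: l a => //= x _ l IHl a; rewrite IHl /=; lia. Qed.

Lemma tree_size_trev l : tree_size (trev l) = tree_size l.
Proof. by rewrite !tree_size_tsum tsum_tfold_id addn0. Qed.

(** Folded over a list of length [n], this prepends [n] zero bits and so multiplies a binary number
    by [2 ^ n]. *)
Definition push_step (t : tree) : tree := Node Leaf (tl t).

Lemma ptime_push_fold : ptime (fun t => tfold push_step (hd t) (tl t)).
Proof.
apply: (@ptime_tfold_additive _ 2) => [|x a /=]; first by rewrite /push_step; solve_ptime.
by have := tree_size_gt0 x; lia.
Qed.
#[local] Hint Resolve ptime_push_fold : ptime_db.

Lemma tree_size_push_fold l a :
  tree_size (tfold push_step l a) <= tree_size a + 2 * tree_size l.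
Proof.
elim: l a => [|x _ l IHl] a; first by rewrite leq_addr.
by apply: leq_trans (IHl _) _; rewrite /=; lia.
Qed.

Definition drop_step (t : tree) : tree := tl (tl t).

Lemma ptime_drop_fold : ptime (fun t => tfold drop_step (hd t) (tl t)).
Proof.
apply: (@ptime_tfold_additive _ 0) => [|x a /=]; first by rewrite /drop_step; solve_ptime.
by rewrite addn0 tree_size_tl.
Qed.
#[local] Hint Resolve ptime_drop_fold : ptime_db.

Lemma tree_size_drop_fold l a :
  tree_size (tfold drop_step l a) <= tree_size a.
Proof. by elim: l a => [|x _ l IHl] a //=; apply: leq_trans (IHl _) (tree_size_tl _). Qed.

(* The head of the accumulator is a read-only context. *)
Lemma ptime_tfold_ctx f C : ptime f ->
  (forall x a, hd (f (Node x a)) = hd a) ->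
  (forall x a, tree_size (f (Node x a)) <=
     tree_size a + C * tree_size x * tree_size (hd a)) ->
  ptime (fun t => tfold f (hd t) (tl t)).
Proof.
move=> pf hdf hf; apply: (@ptime_tfold_bounded f (fun n => n + C * n * n)) => //.
  have pid := poly_bounded_id; have pc := poly_bounded_const.
  apply: poly_bounded_add => //; apply: poly_bounded_mul => //.
  exact: poly_bounded_mul.
have aux l a : tree_size (tfold f l a) <=
    tree_size a + C * tree_size l * tree_size (hd a).
  elim: l a => [|x _ l IHl] a /=; first by lia.
  apply: leq_trans (IHl _) _; rewrite hdf; have := hf x a.
  by move: (tree_size (hd a)) => h; nia.
move=> l a; apply: leq_trans (aux l a) _; have := tree_size_hd a => hh.
apply: leq_add; first by lia.
by apply: leq_mul; [rewrite leq_mul2l; apply/orP; right|]; lia.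
Qed.

(** * Binary arithmetic *)

(** One column of binary subtraction. The accumulator holds the remaining bits of the subtrahend,
    the borrow, and the difference so far in reverse. *)
Definition sub_step (t : tree) : tree :=
  Node (tl (hd (tl t)))
    (Node
      (enc_bool (if is_node (hd t)
                 then is_node (hd (hd (tl t))) && is_node (hd (tl (tl t)))
                 else is_node (hd (hd (tl t))) || is_node (hd (tl (tl t)))))
      (Node (enc_bool (is_node (hd t) (+) is_node (hd (hd (tl t)))
                       (+) is_node (hd (tl (tl t)))))
            (tl (tl (tl t))))).

Lemma ptime_sub_fold : ptime (fun t => tfold sub_step (hd t) (tl t)).
Proof.
apply: (@ptime_tfold_additive _ 10) => [|x s]; first by rewrite /sub_step; solve_ptime.
rewrite /sub_step; set b1 := enc_bool _; set b2 := enc_bool _.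
have h1 : tree_size b1 <= 3 by apply: tree_size_enc_bool.
have h2 : tree_size b2 <= 3 by apply: tree_size_enc_bool.
clearbody b1 b2; have hx := tree_size_gt0 x.
case: s => [|y [|z a]] /=; try have := tree_size_tl y; lia.
Qed.
#[local] Hint Resolve ptime_sub_fold : ptime_db.

Definition tsub (t : tree) : tree :=
  tfold sub_step (hd t) (Node (tl t) (Node Leaf Leaf)).

Lemma ptime_tsub : ptime tsub. Proof. by rewrite /tsub; solve_ptime. Qed.
#[local] Hint Resolve ptime_tsub : ptime_db.

Definition any_step (t : tree) : tree :=
  if is_node (hd t) then enc_bool true else tl t.

Lemma ptime_any_fold : ptime (fun t => tfold any_step (hd t) (tl t)).
Proof.
apply: (@ptime_tfold_additive _ 3) => [|x a].
  by rewrite /any_step; solve_ptime; apply: ptime_enc_bool.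
rewrite /any_step /=; have := tree_size_gt0 x.
by case: ifP => _ /=; lia.
Qed.
#[local] Hint Resolve ptime_any_fold : ptime_db.

(** The first number is subtracted from the second; the comparison holds when no borrow remains and
    the unconsumed bits of the first number are all zero. *)
Definition tle (t : tree) : bool :=
  ~~ is_node (hd (tl (tsub (Node (tl t) (hd t)))))
  && ~~ is_node (tfold any_step (hd (tsub (Node (tl t) (hd t)))) Leaf).

Lemma pcond_tle : pcond tle.
Proof. by rewrite /tle; solve_ptime. Qed.
#[local] Hint Resolve pcond_tle : ptime_db.

Definition tdiff (t : tree) : tree := trev (tl (tl (tsub t))).

Lemma ptime_tdiff : ptime tdiff. Proof. by rewrite /tdiff; solve_ptime. Qed.
#[local] Hint Resolve ptime_tdiff : ptime_db.

Definition tlen : tree -> nat := tsum (fun=> 1).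

Lemma tlen_tdiff a b : tlen (tdiff (Node a b)) = tlen a.
Proof.
rewrite /tdiff /tsub /tlen tsum_tfold_id addn0 /= -!/(tlen _).
suff aux l s : tlen (tl (tl (tfold sub_step l s))) = tlen l + tlen (tl (tl s)).
  by rewrite aux addn0.
by elim: l s => //= x _ l IHl s; rewrite IHl /= /tlen /=; lia.
Qed.

(** Whatever trees stand in [a], each entry of the result is an encoded bit of size at most 3, plus
    one for its list cell. *)
Lemma tree_size_tdiff a b : tree_size (tdiff (Node a b)) <= (4 * tlen a).+1.
Proof.
rewrite /tdiff /tsub tree_size_trev /=.
suff aux l s : tree_size (tl (tl (tfold sub_step l s))) <= 4 * tlen l + tree_size (tl (tl s)).
  by apply: leq_trans (aux _ _) _; rewrite /= addn1.
elim: l s => //= x _ l IHl s; apply: leq_trans (IHl _) _.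
rewrite /sub_step; set b1 := enc_bool _; set b2 := enc_bool _.
have h2 : tree_size b2 <= 3 by apply: tree_size_enc_bool.
by rewrite /tlen /=; lia.
Qed.

(** * The algorithm *)

Definition tkey (t : tree) : tree :=
  if tle (Node (hd t) (hd (tl t))) then hd t else hd (tl t).

Lemma ptime_tkey : ptime tkey. Proof. by rewrite /tkey; solve_ptime. Qed.
#[local] Hint Resolve ptime_tkey : ptime_db.

Lemma tree_size_tkey t : tree_size (tkey t) <= tree_size t.
Proof.
rewrite /tkey; case: ifP => _; first exact: tree_size_hd.
exact: leq_trans (tree_size_hd _) (tree_size_tl _).
Qed.

(** Two lists are consumed in parallel: the adjacency row of the current vertex and the indicator
    list of that vertex. Their disjunction flags its closed neighbourhood. *)
Definition flag_step (t : tree) : tree :=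
  Node (tl (hd (tl t)))
    (Node (tl (hd (tl (tl t))))
      (Node (Node (enc_bool (is_node (hd (hd (tl t)))
                             || is_node (hd (hd (tl (tl t))))))
                  (hd t))
            (tl (tl (tl t))))).

Lemma ptime_flag_fold : ptime (fun t => tfold flag_step (hd t) (tl t)).
Proof.
apply: (@ptime_tfold_additive _ 10) => [|x s]; first by rewrite /flag_step; solve_ptime.
rewrite /flag_step; set b1 := enc_bool _.
have h1 : tree_size b1 <= 3 by apply: tree_size_enc_bool.
clearbody b1; have hx := tree_size_gt0 x.
case: s => [|y [|z a]] /=; try have := tree_size_tl y; try have := tree_size_tl z; lia.
Qed.
#[local] Hint Resolve ptime_flag_fold : ptime_db.

Definition tflag (t : tree) : tree :=
  trev (tl (tl (tfold flag_step (tl (tl t)) (Node (hd t) (Node (hd (tl t)) Leaf))))).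

Lemma ptime_tflag : ptime tflag. Proof. by rewrite /tflag; solve_ptime. Qed.
#[local] Hint Resolve ptime_tflag : ptime_db.

(** The accumulator is [Leaf] until a flagged entry is met, and then carries the least key in its
    head. *)
Definition min_step (t : tree) : tree :=
  if is_node (hd (hd t)) then
    if is_node (tl t) && tle (Node (hd (tl t)) (tkey (tl (hd t)))) then tl t
    else Node (tkey (tl (hd t))) Leaf
  else tl t.

Lemma ptime_min_fold : ptime (fun t => tfold min_step (hd t) (tl t)).
Proof.
apply: (@ptime_tfold_additive _ 3) => [|x s]; first by rewrite /min_step; solve_ptime.
rewrite /min_step /=; have := tree_size_gt0 x; have := tree_size_tl x.
have := tree_size_tkey (tl x).
by case: ifP => _; [case: ifP => _|] => /=; lia.
Qed.
#[local] Hint Resolve ptime_min_fold : ptime_db.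

Definition tmin (l : tree) : tree := hd (tfold min_step l Leaf).

Lemma ptime_tmin : ptime tmin. Proof. by rewrite /tmin; solve_ptime. Qed.
#[local] Hint Resolve ptime_tmin : ptime_db.

(** The middle condition says that this round has not chosen a vertex yet, so ties go to the first
    one. *)
Definition tpick (t : tree) : bool :=
  [&& is_node (hd (hd t)), ~~ is_node (hd (tl (tl t)))
    & tle (Node (tkey (tl (hd t))) (hd (tl t)))].

Lemma pcond_tpick : pcond tpick. Proof. by rewrite /tpick; solve_ptime. Qed.
#[local] Hint Resolve pcond_tpick : ptime_db.

Definition upd_entry (t : tree) : tree :=
  Node (hd (tl (hd t)))
    (Node (if is_node (hd (hd t)) then tdiff (Node (hd (tl (tl (hd t)))) (hd (tl t)))
           else hd (tl (tl (hd t))))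
      (enc_bool (is_node (tl (tl (tl (hd t)))) || tpick t))).

Lemma ptime_upd_entry : ptime upd_entry.
Proof. by rewrite /upd_entry; solve_ptime. Qed.
#[local] Hint Resolve ptime_upd_entry : ptime_db.

Definition upd_step (t : tree) : tree :=
  Node (hd (tl t))
    (Node (enc_bool (is_node (hd (tl (tl t))) || tpick t))
      (Node (upd_entry t) (tl (tl (tl t))))).

(** A subtraction may enlarge the tree of the budget, but keeps its length and stays below the
    second term of the maximum; hence updates never increase the potential. The 6 covers the flag,
    two pairing nodes and a list cell. *)
Definition entry_potential (x : tree) : nat :=
  tree_size (hd x) + maxn (tree_size (hd (tl x))) (4 * tlen (hd (tl x))).+1 + 6.

Lemma tlen_size l : tlen l < tree_size l.
Proof.
rewrite tree_size_tsum /tlen ltnS; elim: l => //= x _ l IHl.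
by have := tree_size_gt0 x; lia.
Qed.

Lemma upd_entry_potential x s :
  entry_potential (upd_entry (Node x s)) <= entry_potential (tl x).
Proof.
rewrite /entry_potential /upd_entry /= leq_add2r leq_add2l.
case: ifP => // _; have := tree_size_tdiff (hd (tl (tl x))) (hd s).
by rewrite tlen_tdiff; lia.
Qed.

Lemma tree_size_upd_entry x s :
  (tree_size (upd_entry (Node x s))).+1 <= entry_potential (tl x).
Proof.
rewrite /entry_potential /upd_entry; set b := enc_bool _.
have hb : tree_size b <= 3 by apply: tree_size_enc_bool.
rewrite /=; case: ifP => _; last by lia.
by have := tree_size_tdiff (hd (tl (tl x))) (hd s); lia.
Qed.

Lemma entry_potential_size x : entry_potential x <= 12 * tree_size x.
Proof.
rewrite /entry_potential; have := tlen_size (hd (tl x)); have := tree_size_gt0 x.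
by case: x => [|l [|r c]] //=; rewrite /tlen /=; try lia; have := tree_size_gt0 l; lia.
Qed.

Lemma ptime_upd_fold : ptime (fun t => tfold upd_step (hd t) (tl t)).
Proof.
apply: (@ptime_tfold_additive _ 20) => [|x s]; first by rewrite /upd_step; solve_ptime.
have := tree_size_upd_entry x s; have := entry_potential_size (tl x).
have := tree_size_tl x; have := tree_size_gt0 x.
rewrite /upd_step; set b := enc_bool _.
have hb : tree_size b <= 3 by apply: tree_size_enc_bool.
clearbody b; move: (upd_entry _) => e.
by case: s => [|y [|z a]] /=; lia.
Qed.
#[local] Hint Resolve ptime_upd_fold : ptime_db.

Definition tupdate (t : tree) : tree :=
  trev (tl (tl (tfold upd_step t (Node (tmin t) (Node Leaf Leaf))))).

Lemma ptime_tupdate : ptime tupdate. Proof. by rewrite /tupdate; solve_ptime. Qed.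
#[local] Hint Resolve ptime_tupdate : ptime_db.

Lemma tsum_tupdate (g : tree -> nat) l :
  (forall x s, g (upd_entry (Node x s)) <= entry_potential (tl x)) ->
  tsum g (tupdate l) <= tsum (fun x => entry_potential (tl x)) l.
Proof.
move=> hg; rewrite /tupdate tsum_tfold_id addn0.
suff aux k s : tsum g (tl (tl (tfold upd_step k s))) <=
    tsum (fun x => entry_potential (tl x)) k + tsum g (tl (tl s)).
  by apply: leq_trans (aux _ _) _; rewrite addn0.
elim: k s => //= x _ k IHk s; apply: leq_trans (IHk _) _.
by have := hg x s; rewrite /upd_step /=; lia.
Qed.

Lemma tsum_tflag g t : tsum (fun x => g (tl x)) (tflag t) = tsum g (tl (tl t)).
Proof.
rewrite /tflag tsum_tfold_id addn0.
suff aux k s : tsum (fun x => g (tl x)) (tl (tl (tfold flag_step k s))) =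
    tsum g k + tsum (fun x => g (tl x)) (tl (tl s)).
  by rewrite aux addn0.
by elim: k s => //= x _ k IHk s; rewrite IHk /=; lia.
Qed.

(** The head of the accumulator is the indicator list of the current vertex; prepending a zero moves
    on to the next one. *)
Definition round_step (t : tree) : tree :=
  Node (Node Leaf (hd (tl t))) (tupdate (tflag t)).

(** Iterating a polynomial size bound could give exponential growth. The potential of the entries
    does not grow at all, and the indicator list grows by one zero per round. *)
Lemma ptime_round_fold : ptime (fun t => tfold round_step (hd t) (tl t)).
Proof.
apply: (@ptime_tfold round_step
  (fun s => tree_size (hd s) + tsum entry_potential (tl s)) 14) => [|s|x s|x s].
- by rewrite /round_step; solve_ptime.
- suff h l : tsum entry_potential l <= 12 * tree_size l.
    have := h (tl s); case: s => [|a b] /=; lia.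
  rewrite tree_size_tsum; elim: l => //= x _ l IHl.
  by have := entry_potential_size x; lia.
- rewrite /round_step /=; have := tree_size_gt0 x.
  have := tsum_tupdate (tflag (Node x s)) upd_entry_potential.
  by rewrite tsum_tflag /=; lia.
- rewrite /round_step /= [tree_size (tupdate _)]tree_size_tsum.
  have := @tsum_tupdate (fun x => (tree_size x).+1) (tflag (Node x s))
    tree_size_upd_entry.
  rewrite tsum_tflag /=; have := tree_size_gt0 x; have := tree_size_gt0 (hd s).
  by lia.
Qed.
#[local] Hint Resolve ptime_round_fold : ptime_db.

(** Over all costs the zeros add up to the total length of the denominators, a common exponent large
    enough for each of them. *)
Definition zeros_step (t : tree) : tree := tfold push_step (tl (hd t)) (tl t).

Lemma ptime_zeros_fold : ptime (fun t => tfold zeros_step (hd t) (tl t)).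
Proof.
apply: (@ptime_tfold_additive _ 2) => [|x a]; first by rewrite /zeros_step; solve_ptime.
apply: leq_trans (tree_size_push_fold _ _) _.
by rewrite /= leq_add2l leq_mul2l tree_size_tl.
Qed.
#[local] Hint Resolve ptime_zeros_fold : ptime_db.

(* For a cost [p / q] and a list [Z] of zeros at least as long as [q], the
   number [2 ^ (|Z| + |p| - |q|)], which is [2 ^ |Z| * (p / q)] up to a factor
   of [2]. *)
Definition tweight (t : tree) : tree :=
  if is_node (hd (hd t)) then
    tfold push_step (hd (hd t))
      (tfold push_step (tfold drop_step (tl (hd t)) (tl t)) (Node (enc_bool true) Leaf))
  else Leaf.

Lemma ptime_tweight : ptime tweight.
Proof. by rewrite /tweight; solve_ptime. Qed.
#[local] Hint Resolve ptime_tweight : ptime_db.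

Lemma tree_size_tweight c Z :
  tree_size (tweight (Node c Z)) <= 2 * tree_size c + 2 * tree_size Z + 5.
Proof.
rewrite /tweight /=; case: ifP => _; last by rewrite /=; lia.
apply: leq_trans (tree_size_push_fold _ _) _.
have := tree_size_push_fold (tfold drop_step (tl c) Z) (Node (enc_bool true) Leaf).
by have := tree_size_drop_fold (tl c) Z; have := tree_size_hd c => /=; lia.
Qed.

Section Initialisation.
Variable a : nat.

(** The budget factor [kappa] is taken to be [2 ^ a], so that multiplying by it is a shift. *)
Definition tshift (t : tree) : tree := iter a (Node Leaf) t.

Lemma ptime_tshift : ptime tshift.
Proof.
rewrite /tshift; elim: a => [|n IHn] /=; first exact: ptime_id.
exact: ptime_node ptime_leaf IHn.
Qed.

Lemma tree_size_tshift t : tree_size (tshift t) = tree_size t + 2 * a.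
Proof. by rewrite /tshift; elim: a => [|n IHn] /=; lia. Qed.

Definition init_step (t : tree) : tree :=
  Node (hd (tl t))
    (Node (Node (tweight (Node (hd t) (hd (tl t))))
             (Node (tshift (tweight (Node (hd t) (hd (tl t))))) Leaf))
          (tl (tl t))).

Lemma ptime_init_fold : ptime (fun t => tfold init_step (hd t) (tl t)).
Proof.
have psh := ptime_tshift.
apply: (@ptime_tfold_ctx _ (30 + 2 * a)) => [|x s|x s] //.
  by rewrite /init_step; solve_ptime; apply: ptime_comp psh _; solve_ptime.
rewrite /init_step /= tree_size_tshift.
have := tree_size_tweight x (hd s).
have := tree_size_gt0 x; have := tree_size_gt0 (hd s).
move: (tweight _) => w hs hx hw.
have hsx : tree_size x + tree_size (hd s) <= (tree_size x * tree_size (hd s)).+1 by nia.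
rewrite -mulnA; move: hsx hw; set q := tree_size x * _.
have q0 : 0 < q by rewrite /q; nia.
have : tree_size (hd s) + tree_size (tl s) <= (tree_size s).+1 by case: (s) => //= ? ?; lia.
move: (tree_size w) (tree_size x) (tree_size (hd s)) (tree_size (tl s)) (tree_size s) q q0.
move=> {hs hx w x s} w x h l s q q0.
have haq : a <= a * q by rewrite leq_pmulr.
nia.
Qed.
#[local] Hint Resolve ptime_init_fold : ptime_db.

Definition tinit (t : tree) : tree :=
  trev (tl (tfold init_step t (Node (tfold zeros_step t Leaf) Leaf))).

Lemma ptime_tinit : ptime tinit. Proof. by rewrite /tinit; solve_ptime. Qed.
#[local] Hint Resolve ptime_tinit : ptime_db.

Definition out_step (t : tree) : tree := Node (tl (tl (hd t))) (tl t).

Lemma ptime_out_fold : ptime (fun t => tfold out_step (hd t) (tl t)).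
Proof.
apply: (@ptime_tfold_additive _ 2) => [|x s]; first by rewrite /out_step; solve_ptime.
rewrite /out_step /=; have := tree_size_gt0 x.
by have := tree_size_tl x; have := tree_size_tl (tl x); lia.
Qed.
#[local] Hint Resolve ptime_out_fold : ptime_db.

(** The rows of the adjacency matrix drive the main loop; the indicator list starts at the first
    vertex. *)
Definition tgreedy (t : tree) : tree :=
  trev (tfold out_step
    (tl (tfold round_step (hd t) (Node (Node (enc_bool true) Leaf) (tinit (hd (tl t)))))) Leaf).

Lemma ptime_tgreedy : ptime tgreedy.
Proof. by rewrite /tgreedy; solve_ptime. Qed.

End Initialisation.

(** * Correctness of the tree programs *)

Definition bits (s : seq bool) : tree := enc_seq enc_bool s.

Fixpoint bval (s : seq bool) : nat := if s is b :: s' then b + (bval s').*2 else 0.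

Lemma bval_lt s : bval s < 2 ^ size s.
Proof. by elim: s => //= b s IHs; rewrite expnS; case: b; lia. Qed.

Lemma bval_nseq n s : bval (nseq n false ++ s) = 2 ^ n * bval s.
Proof. by elim: n => [|n IHn] /=; rewrite ?mul1n // IHn expnS; lia. Qed.

Lemma is_node_enc_bool b : is_node (enc_bool b) = b. Proof. by case: b. Qed.

Lemma is_node_hd_bits s : is_node (hd (bits s)) = head false s.
Proof. by case: s => //= b s; rewrite is_node_enc_bool. Qed.

Lemma tl_bits s : tl (bits s) = bits (behead s). Proof. by case: s. Qed.

Lemma enc_seq_map (T U : Type) (enc : U -> tree) (f : T -> U) s :
  enc_seq enc [seq f x | x <- s] = enc_seq (fun x => enc (f x)) s.
Proof. by elim: s => //= x s ->. Qed.

Lemma eq_in_enc_seq (T : eqType) (f g : T -> tree) (s : seq T) :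
  {in s, f =1 g} -> enc_seq f s = enc_seq g s.
Proof.
elim: s => //= x s IHs fg; rewrite fg ?mem_head // IHs // => y ys.
by apply: fg; rewrite inE ys orbT.
Qed.

Lemma trevK_enc_seq (T : Type) (f : T -> tree) (s : seq T) :
  trev (tfold (fun t => t) (enc_seq f s) Leaf) = enc_seq f s.
Proof.
suff aux a : forall r, tfold (fun t => t) (tfold (fun t => t) (enc_seq f s) a) r =
    tfold (fun t => t) a (foldr (fun x t => Node (f x) t) r s) by rewrite /trev aux.
by elim: s a => //= x s IHs a r; rewrite IHs.
Qed.

Fixpoint sub_bits (c : bool) (s t : seq bool) : seq bool :=
  if s is x :: s' then
    x (+) head false t (+) c ::
      sub_bits (if x then head false t && c else head false t || c) s' (behead t)
  else [::].

Fixpoint sub_borrow (c : bool) (s t : seq bool) : bool :=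
  if s is x :: s' then
    sub_borrow (if x then head false t && c else head false t || c) s' (behead t)
  else c.

(** The final borrow and the unconsumed part of [t] both weigh [2 ^ size s]; moving negative terms
    across keeps the identity within the natural numbers. *)
Lemma sub_bitsE c s t :
  bval (sub_bits c s t) + bval t + c =
  bval s + 2 ^ size s * (sub_borrow c s t + bval (drop (size s) t)).
Proof.
elim: s c t => [|x s IHs] c t /=; first by rewrite drop0 mul1n; lia.
have -> : drop (size s).+1 t = drop (size s) (behead t) by case: t.
have -> : bval t = head false t + (bval (behead t)).*2 by case: t.
rewrite expnS -mulnA; set Z := 2 ^ _ * _.
move: (IHs (if x then head false t && c else head false t || c) (behead t)).
rewrite -/Z; clearbody Z; case: x; case: (head false t); case: c => /=; lia.
Qed.

Lemma tfold_sub_step c s t acc :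
  tfold sub_step (bits s) (Node (bits t) (Node (enc_bool c) acc)) =
  Node (bits (drop (size s) t)) (Node (enc_bool (sub_borrow c s t))
    (tfold (fun t => t) (bits (sub_bits c s t)) acc)).
Proof.
elim: s c t acc => [|x s IHs] c t acc /=; first by rewrite drop0.
rewrite {2}/sub_step /= !is_node_enc_bool is_node_hd_bits tl_bits IHs.
by case: t => [|y t].
Qed.

Lemma tfold_any_step s :
  is_node (tfold any_step (bits s) Leaf) = (bval s != 0).
Proof.
suff aux a : is_node (tfold any_step (bits s) a) = (bval s != 0) || is_node a.
  by rewrite aux orbF.
elim: s a => //= b s IHs a; rewrite IHs /any_step /= is_node_enc_bool.
by case: b => /=; rewrite ?orbT //=; case: (bval s).
Qed.

Lemma tleE s t : tle (Node (bits s) (bits t)) = (bval s <= bval t).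
Proof.
rewrite /tle /tsub /= -[Node Leaf Leaf]/(Node (enc_bool false) Leaf).
rewrite tfold_sub_step /= is_node_enc_bool tfold_any_step negbK.
(* The difference is below [2 ^ size t], so a borrow or a nonzero rest forces [bval t < bval s]. *)
have := sub_bitsE false t s; have := bval_lt (sub_bits false t s).
have -> : size (sub_bits false t s) = size t.
  by elim: (t) false (s) => //= x t' IHt c s'; rewrite IHt.
move: (sub_borrow _ _ _) (bval (drop _ _)) => b r; move: (2 ^ _) => P.
case: b => /=; case: r => [|r] /=; nia.
Qed.

Lemma tdiffE s t :
  tdiff (Node (bits s) (bits t)) = bits (sub_bits false s t).
Proof.
rewrite /tdiff /tsub /= -[Node Leaf Leaf]/(Node (enc_bool false) Leaf).
by rewrite tfold_sub_step /= trevK_enc_seq.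
Qed.

Lemma bval_sub_bits s t : bval t <= bval s ->
  bval (sub_bits false s t) = bval s - bval t.
Proof.
move=> ts; have := sub_bitsE false s t; have := bval_lt (sub_bits false s t).
have -> : size (sub_bits false s t) = size s.
  by elim: (s) false (t) => //= x s' IHs c t'; rewrite IHs.
move: (_ + bval (drop _ _)) (2 ^ _) => Z P; case: Z => [|Z]; nia.
Qed.

(* Weight, residual budget, and whether the vertex has been chosen. *)
Definition entry := (seq bool * seq bool * bool)%type.

Definition enc_entry (x : entry) : tree :=
  Node (bits x.1.1) (Node (bits x.1.2) (enc_bool x.2)).

Definition key (x : entry) : seq bool :=
  if bval x.1.1 <= bval x.1.2 then x.1.1 else x.1.2.

Lemma bval_key x : bval (key x) = minn (bval x.1.1) (bval x.1.2).
Proof. by rewrite /key; case: leqP. Qed.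

Lemma tkeyE x : tkey (enc_entry x) = bits (key x).
Proof. by rewrite /tkey /key /= tleE; case: ifP. Qed.

(** * Correctness of one round *)

Section Round.
Variable T : eqType.
Implicit Types (l : seq T) (fl : T -> bool) (E : T -> entry) (d : seq bool).

(** Past the end of a list the default [false] matches the tree program, in which [hd Leaf] is
    [Leaf]; the indicator list may be shorter than [l]. *)
Lemma tflagE (f : T -> tree) l fl row e x0 :
  (forall i, i < size l -> fl (nth x0 l i) = nth false row i || nth false e i) ->
  tflag (Node (bits row) (Node (bits e) (enc_seq f l))) =
  enc_seq (fun x => Node (enc_bool (fl x)) (f x)) l.
Proof.
move=> hfl; rewrite /tflag /=.
suff aux acc : tl (tl (tfold flag_step (enc_seq f l)
    (Node (bits row) (Node (bits e) acc)))) =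
    tfold (fun t => t) (enc_seq (fun x => Node (enc_bool (fl x)) (f x)) l) acc.
  by rewrite aux trevK_enc_seq.
elim: l row e acc hfl => //= x l IHl row e acc hfl.
rewrite /flag_step /= !is_node_hd_bits !tl_bits -/flag_step IHl.
  by have /= := hfl 0 isT; rewrite !nth0 => ->.
by move=> i il; rewrite !nth_behead; apply: (hfl i.+1).
Qed.

Definition enc_flagged fl E (x : T) : tree :=
  Node (enc_bool (fl x)) (enc_entry (E x)).

Lemma tfold_min_step fl E l (k : seq bool) :
  exists2 k', tfold min_step (enc_seq (enc_flagged fl E) l) (Node (bits k) Leaf) =
              Node (bits k') Leaf &
    [/\ bval k' <= bval k, {in l, forall x, fl x -> bval k' <= bval (key (E x))} &
        k' = k \/ exists2 x, x \in l & fl x /\ k' = key (E x)].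
Proof.
elim: l k => [|x l IHl] k /=; first by exists k => //; split=> //; left.
rewrite {2}/min_step /= is_node_enc_bool.
have -> : tkey (Node (bits (E x).1.1) (Node (bits (E x).1.2) (enc_bool (E x).2)))
  = bits (key (E x)) by exact: tkeyE.
rewrite tleE /=.
pose k1 := if fl x && ~~ (bval k <= bval (key (E x))) then key (E x) else k.
have -> : (if fl x then if bval k <= bval (key (E x)) then Node (bits k) Leaf
    else Node (bits (key (E x))) Leaf else Node (bits k) Leaf) = Node (bits k1) Leaf.
  by rewrite /k1; case: (fl x) => //=; case: leqP.
have [k' -> [k'k1 k'l k'E]] := IHl k1; exists k' => //.
have k1k : bval k1 <= bval k /\ (fl x -> bval k1 <= bval (key (E x))).
  rewrite /k1; case: (fl x) => /=; last by split.
  by case: (leqP (bval k) (bval (key (E x)))) => /= h; split=> //; apply: ltnW.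
split.
- by case: k1k; lia.
- move=> y; rewrite inE => /predU1P[-> flx|yl]; last exact: k'l.
  by case: k1k => _ /(_ flx); lia.
- case: k'E => [->|[y yl [fly k'y]]]; last first.
    by right; exists y; rewrite ?inE ?yl ?orbT.
  rewrite /k1; case: ifP => [/andP[flx _]|_]; last by left.
  by right; exists x; rewrite ?mem_head.
Qed.

(** Entries before the first flagged one leave the accumulator empty; from there on [tfold_min_step]
    applies. *)
Lemma tminE fl E l : has fl l -> exists2 x, x \in l &
  [/\ fl x, tmin (enc_seq (enc_flagged fl E) l) = bits (key (E x)) &
      {in l, forall y, fl y -> bval (key (E x)) <= bval (key (E y))}].
Proof.
rewrite /tmin; elim: l => //= x l IHl.
rewrite {2}/min_step /= is_node_enc_bool.
have -> : tkey (Node (bits (E x).1.1) (Node (bits (E x).1.2) (enc_bool (E x).2)))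
  = bits (key (E x)) by exact: tkeyE.
case flx: (fl x) => /= hl; last first.
  have [y yl [fly -> ymin]] := IHl hl; exists y; first by rewrite inE yl orbT.
  split=> // z; rewrite inE => /predU1P[->|]; first by rewrite flx.
  exact: ymin.
have [k' -> [k'x k'l k'E]] := tfold_min_step fl E l (key (E x)).
case: k'E => [k'E|[y yl [fly k'E]]].
  exists x; first exact: mem_head.
  split=> //; first by rewrite k'E.
  by move=> y; rewrite inE => /predU1P[-> //|yl]; rewrite -k'E; apply: k'l.
exists y; first by rewrite inE yl orbT.
split=> //; first by rewrite k'E.
by move=> z; rewrite inE -k'E => /predU1P[-> //|zl]; apply: k'l.
Qed.

Definition updated fl E d (pick : pred T) (x : T) : entry :=
  ((E x).1.1, if fl x then sub_bits false (E x).1.2 d else (E x).1.2,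
   (E x).2 || pick x).

Lemma upd_stepE fl E d done acc x :
  let p := [&& fl x, ~~ done & bval (key (E x)) <= bval d] in
  upd_step (Node (enc_flagged fl E x) (Node (bits d) (Node (enc_bool done) acc))) =
  Node (bits d) (Node (enc_bool (done || p))
    (Node (enc_entry (updated fl E d (fun=> p) x)) acc)).
Proof.
move=> p; rewrite /upd_step /upd_entry /=.
have -> : tpick (Node (enc_flagged fl E x) (Node (bits d) (Node (enc_bool done) acc))) = p.
  rewrite /tpick /= !is_node_enc_bool.
  have -> : tkey (Node (bits (E x).1.1) (Node (bits (E x).1.2) (enc_bool (E x).2)))
    = bits (key (E x)) by exact: tkeyE.
  by rewrite tleE.
rewrite !is_node_enc_bool /updated /enc_entry /= tdiffE.
by case: (fl x).
Qed.

Lemma tfold_upd_step_done fl E d l acc :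
  tfold upd_step (enc_seq (enc_flagged fl E) l)
    (Node (bits d) (Node (enc_bool true) acc)) =
  Node (bits d) (Node (enc_bool true)
    (tfold (fun t => t) (enc_seq (fun x => enc_entry (updated fl E d pred0 x)) l) acc)).
Proof.
elim: l acc => // x l IHl acc.
rewrite -[LHS]/(tfold upd_step (enc_seq (enc_flagged fl E) l) (upd_step
  (Node (enc_flagged fl E x) (Node (bits d) (Node (enc_bool true) acc))))).
by rewrite upd_stepE andbF IHl.
Qed.

(** The first entry passing the test sets the [done] bit, after which nothing is chosen; uniqueness
    makes [pred1 x] single out that entry. *)
Lemma tfold_upd_step fl E d l acc : uniq l ->
  has (fun x => fl x && (bval (key (E x)) <= bval d)) l ->
  exists2 x, x \in l & [/\ fl x, bval (key (E x)) <= bval d &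
    tl (tl (tfold upd_step (enc_seq (enc_flagged fl E) l)
      (Node (bits d) (Node (enc_bool false) acc)))) =
    tfold (fun t => t) (enc_seq (fun y => enc_entry (updated fl E d (pred1 x) y)) l) acc].
Proof.
elim: l acc => // x l IHl acc /= /andP[xl ul].
rewrite -/(enc_bool false) -/(enc_flagged fl E x) upd_stepE andTb orFb.
have [/andP[flx kx] _|np /= hl] := boolP (fl x && _).
  exists x; first exact: mem_head; split=> //.
  rewrite tfold_upd_step_done /=; congr (tfold _ _ (Node _ _)).
    apply: eq_in_enc_seq => y yl; congr enc_entry.
    rewrite /updated /=; case: eqP => // yx; by rewrite -yx yl in xl.
  by rewrite /updated /= eqxx.
have [y yl [fly ky eqy]] := IHl (Node (enc_entry (updated fl E d pred0 x)) acc) ul hl.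
exists y; first by rewrite inE yl orbT.
split=> //; rewrite -[RHS]/(tfold _ _ (Node _ _)).
have -> : updated fl E d (pred1 y) x = updated fl E d pred0 x.
  rewrite /updated /=; case: eqP => // xy; by rewrite xy yl in xl.
by rewrite -eqy.
Qed.

Lemma round_stepE fl E l row e x0 : uniq l -> has fl l ->
  (forall i, i < size l -> fl (nth x0 l i) = nth false row i || nth false e i) ->
  exists2 x, x \in l & exists d : seq bool,
    [/\ fl x, bval d = bval (key (E x)),
        {in l, forall y, fl y -> bval d <= bval (key (E y))} &
        round_step (Node (bits row) (Node (bits e) (enc_seq (fun y => enc_entry (E y)) l))) =
        Node (bits (false :: e))
             (enc_seq (fun y => enc_entry (updated fl E d (pred1 x) y)) l)].
Proof.
move=> ul hl hfl.
have [x0' x0l [flx0 minE mind]] := tminE E hl.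
set d := key (E x0') in minE mind.
(* The vertex chosen by the update is not known to be [x0'], but its key has the same value. *)
have [|x xl [flx kx eqx]] := @tfold_upd_step fl E d l Leaf ul.
  by apply/hasP; exists x0' => //; rewrite flx0 leqnn.
exists x => //; exists d; split=> //.
  by apply/eqP; rewrite eqn_leq kx mind.
rewrite /round_step (tflagE _ hfl) -/(enc_flagged fl E) /tupdate minE.
rewrite -[Node Leaf Leaf]/(Node (enc_bool false) Leaf) eqx.
by rewrite trevK_enc_seq.
Qed.

End Round.

(** * Correctness of the rounded weights and of the output *)

Lemma tfold_push_step s t :
  tfold push_step (bits s) (bits t) = bits (nseq (size s) false ++ t).
Proof.
elim: s t => //= b s IHs t; rewrite /push_step /= -[Node Leaf _]/(bits (false :: t)) IHs.
by elim: (size s) => //= n ->.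
Qed.

Lemma tfold_drop_step s t :
  tfold drop_step (bits s) (bits t) = bits (drop (size s) t).
Proof.
elim: s t => [|b s IHs] t /=; first by rewrite drop0.
by rewrite /drop_step /= tl_bits IHs; case: t.
Qed.

Lemma tshiftE a s : tshift a (bits s) = bits (nseq a false ++ s).
Proof. by rewrite /tshift; elim: a => //= a ->. Qed.

Definition weight (M : nat) (p q : seq bool) : seq bool :=
  if p is [::] then [::] else nseq (size p + (M - size q)) false ++ [:: true].

Lemma tweightE M p q :
  tweight (Node (Node (bits p) (bits q)) (bits (nseq M false))) = bits (weight M p q).
Proof.
rewrite /tweight /= -[Node (Node Leaf Leaf) Leaf]/(bits [:: true]) tfold_drop_step.
rewrite !tfold_push_step size_drop size_nseq catA -nseqD.
by case: p.
Qed.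

Section Init.
Variables (T : Type) (P Q : T -> seq bool) (a : nat).

Definition enc_frac (x : T) : tree := Node (bits (P x)) (bits (Q x)).

Lemma tfold_zeros_step l :
  tfold zeros_step (enc_seq enc_frac l) Leaf =
  bits (nseq (\sum_(x <- l) size (Q x)) false).
Proof.
suff aux m : tfold zeros_step (enc_seq enc_frac l) (bits (nseq m false)) =
  bits (nseq (\sum_(x <- l) size (Q x) + m) false) by rewrite (aux 0) addn0.
elim: l m => [|x l IHl] m /=; first by rewrite big_nil.
rewrite {2}/zeros_step /= tfold_push_step -nseqD IHl big_cons.
by congr (bits (nseq _ _)); lia.
Qed.

Lemma tinitE l (M := \sum_(x <- l) size (Q x)) :
  tinit a (enc_seq enc_frac l) =
  enc_seq (fun x => enc_entry (weight M (P x) (Q x),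
    nseq a false ++ weight M (P x) (Q x), false)) l.
Proof.
rewrite /tinit tfold_zeros_step -/M.
set f := fun x => enc_entry _.
suff aux k acc : tl (tfold (init_step a) (enc_seq enc_frac k)
    (Node (bits (nseq M false)) acc)) = tfold (fun t => t) (enc_seq f k) acc.
  by rewrite aux trevK_enc_seq.
elim: k acc => //= x k IHk acc; rewrite {2}/init_step /= tweightE tshiftE IHk.
by [].
Qed.

End Init.

Lemma tfold_out_step (T : Type) (E : T -> entry) l :
  trev (tfold out_step (enc_seq (fun x => enc_entry (E x)) l) Leaf) =
  enc_seq (fun x => enc_bool (E x).2) l.
Proof.
suff aux acc : tfold out_step (enc_seq (fun x => enc_entry (E x)) l) acc =
  tfold (fun t => t) (enc_seq (fun x => enc_bool (E x).2) l) acc.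
  by rewrite aux trevK_enc_seq.
by elim: l acc => //= x l IHl acc; rewrite IHl.
Qed.

Lemma pos_bits_bounds p : (0 < size (pos_bits p)) /\
  2 ^ (size (pos_bits p)).-1 <= nat_of_pos p < 2 ^ size (pos_bits p).
Proof.
elim: p => [p [s0 IHp]|p [s0 IHp]|] //=; split=> //.
all: move: s0 IHp; rewrite NatTrec.doubleE; case: (size _) => // n _; rewrite !expnS /=; lia.
Qed.

Lemma nat_bits_bounds n : 0 < n ->
  2 ^ size (nat_bits n) <= 2 * n /\ n < 2 ^ size (nat_bits n).
Proof.
rewrite /nat_bits -{1 3 4}(bin_of_natK n); case: (bin_of_nat n) => [//|p] _ /=.
have [s0 /andP[h1 h2]] := pos_bits_bounds p; split=> //.
by move: s0 h1; case: (size _) => // k _; rewrite expnS leq_mul2l.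
Qed.

Lemma nat_bits_nonnil n : 0 < n -> 0 < size (nat_bits n).
Proof. by move=> n0; have [_] := nat_bits_bounds n0; case: (size _) => //; lia. Qed.

Local Open Scope ring_scope.

(** * Greedy packing *)

Lemma closed_nbh_sym (G : sgraph) (u v : G) :
  (u \in closed_nbh v) = (v \in closed_nbh u).
Proof. by rewrite !inE adj_sym eq_sym. Qed.

Section GreedyPacking.
Variables (K : realFieldType) (G : sgraph) (w : G -> K) (kappa : nat).
Hypothesis w_ge0 : forall v, 0 <= w v.

Definition load (y : G -> K) (v : G) : K := \sum_(u in closed_nbh v) y u.

(* The vertices of [s] have been processed: [y] is the packing (a dual solution
   up to the factor [kappa]), [r] the residual budgets, and [D] the chosen
   vertices, one vertex [a u] for each [u] in [s]. *)
Definition greedy_state (s : seq G) (r : G -> K) (D : {set G}) : Prop :=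
  exists (y : G -> K) (a : G -> G),
  [/\ (forall u, 0 <= y u) /\ (forall v, 0 <= r v),
      forall v, load y v + r v = kappa%:R * w v,
      forall u v, v \in closed_nbh u -> y u <= w v,
      forall u, u \notin s -> y u = 0
    & (forall u, u \in s ->
         a u \in closed_nbh u /\ (y u = w (a u) \/ r (a u) = 0)) /\
      D = [set a u | u in s]].

Lemma greedy_init : greedy_state [::] (fun v => kappa%:R * w v) set0.
Proof.
exists (fun=> 0), id; split=> //.
- by split=> // v; rewrite mulr_ge0.
- by move=> v; rewrite /load big1 // add0r.
- by split=> //; apply/setP => v; rewrite inE; apply/esym/negP => /imsetP[].
Qed.

Lemma greedy_step s r D u v0 d r' :
  greedy_state s r D -> u \notin s -> v0 \in closed_nbh u ->
  d = Num.min (w v0) (r v0) ->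
  (forall v, v \in closed_nbh u -> d <= w v /\ d <= r v) ->
  (forall v, r' v = if v \in closed_nbh u then r v - d else r v) ->
  greedy_state (u :: s) r' (v0 |: D).
Proof.
move=> [y [a [[y0 r0] yr yw ys [as_ ->]]]] us v0u dE dmin r'E.
have d0 : 0 <= d by rewrite dE le_min w_ge0 r0.
pose y' x := if x == u then d else y x.
pose a' x := if x == u then v0 else a x.
have yu : y u = 0 by apply: ys.
have loadE v : load y' v = load y v + (if v \in closed_nbh u then d else 0).
  rewrite /load -closed_nbh_sym; case: ifP => uv; last first.
    rewrite addr0; apply: eq_bigr => x xv; rewrite /y'; case: eqP => // xu.
    by rewrite -xu xv in uv.
  rewrite (bigD1 u) //= [in RHS](bigD1 u) //= yu add0r addrC /y' eqxx.
  by congr (_ + _); apply: eq_bigr => x /andP[_ /negbTE->].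
have neq_us x : x \in s -> (x == u) = false.
  by move=> xs; apply/negbTE; apply: contraNneq us => <-.
have r'0 v : 0 <= r' v.
  by rewrite r'E; case: ifP => // /dmin[_]; rewrite subr_ge0.
exists y', a'; split=> //.
- by split=> // x; rewrite /y'; case: eqP.
- by move=> v; rewrite loadE r'E -yr; case: ifP => _; ring.
- move=> x v; rewrite /y'; case: eqP => [->|_]; last exact: yw.
  by move/dmin => [].
- move=> x; rewrite inE negb_or => /andP[/negbTE xu xs].
  by rewrite /y' xu; apply: ys.
split.
  move=> x; rewrite inE; case/predU1P => [->|xs].
    rewrite /a' /y' eqxx v0u; split=> //; rewrite r'E v0u dE.
    by case: leP => _; [left|right; rewrite subrr].
  rewrite /a' /y' neq_us //; have [-> [yw'|ra0]] := as_ x xs; split=> //; first by left.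
  (* An exhausted budget stays exhausted, since budgets only decrease and remain nonnegative. *)
  right; apply/eqP; rewrite eq_le r'0 andbT r'E ra0.
  by case: ifP => // _; rewrite sub0r oppr_le0.
apply/setP => z; rewrite !inE; apply/orP/imsetP => [[/eqP->|/imsetP[x xs ->]]|[x]].
- by exists u; rewrite ?inE ?eqxx // /a' eqxx.
- by exists x; rewrite ?inE ?xs ?orbT // /a' neq_us.
- rewrite inE => /predU1P[->|xs] ->; first by left; rewrite /a' eqxx.
  by right; apply/imsetP; exists x => //; rewrite /a' neq_us.
Qed.

Lemma greedy_run (s : seq G) :
  uniq s -> exists r D, greedy_state s r D.
Proof.
elim: s => [_|u s IHs /= /andP[us /IHs[r [D st]]]].
  by exists (fun v => kappa%:R * w v), set0; apply: greedy_init.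
pose key v := Num.min (w v) (r v).
have uu : u \in closed_nbh u by rewrite !inE eqxx.
case: (Order.TotalTheory.arg_minP key uu) => v0 v0u hmin.
eexists; exists (v0 |: D); apply: (greedy_step st us v0u) => [//||v]; last reflexivity.
by move=> v vu; have := hmin v vu; rewrite {2}/key le_min => /andP[].
Qed.

Section Cost.
Variables (s : seq G) (r : G -> K) (D : {set G}).
Hypotheses (st : greedy_state s r D) (sG : forall u, u \in s).

Lemma greedy_dominating : dominating D.
Proof.
have [y [a [_ _ _ _ [has ->]]]] := st.
apply/forallP => v; apply/implyP => vD; apply/existsP; exists (a v).
have [av _] := has v (sG v); have aD : a v \in [set a u | u in s] by apply: imset_f.
rewrite aD andbT; move: av; rewrite !inE => /orP[/eqP av|//].
by rewrite -av aD in vD.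
Qed.

Variables (o : rel G) (d : nat).
Hypotheses (o_adj : forall u v, adj u v -> o u v || o v u)
  (o_deg : forall u, (#|[set v | o u v]| <= d)%N) (kappa_big : (d.*2.+1 <= kappa)%N).

(* The out-neighbours of a tight vertex [v] contribute at most [d * w v] to its
   load [kappa * w v], so its in-neighbours and [v] itself pay for the rest. *)
Lemma tight_cost (y : G -> K) :
  (forall u, 0 <= y u) -> (forall u v, v \in closed_nbh u -> y u <= w v) ->
  \sum_(v | load y v == kappa%:R * w v) w v <= \sum_u y u.
Proof.
move=> y0 yw.
have d1 : 0 < d.+1%:R :> K by rewrite ltr0n.
rewrite -(ler_pM2l d1).
apply: (@le_trans _ _ (\sum_(v | load y v == kappa%:R * w v)
    (y v + \sum_(u | o u v) y u))).
  rewrite mulr_sumr; apply: ler_sum => v /eqP tight.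
  have hload : load y v <= y v + (\sum_(u | o u v) y u + \sum_(u | o v u && adj v u) y u).
    rewrite /load (bigD1 v) ?inE ?eqxx //= lerD2l.
    rewrite [leLHS]big_mkcond [X in _ <= X + _]big_mkcond [X in _ <= _ + X]big_mkcond.
    rewrite -big_split /=; apply: ler_sum => u _; have := y0 u.
    rewrite !inE; case: (eqVneq u v) => [->|uv] /=.
      by rewrite adj_irr andbF; case: ifP => _; lra.
    rewrite andbT; case: ifP => [vu|_]; last by case: ifP; case: ifP; lra.
    by have := o_adj vu; case: (o v u); case: (o u v) => //=; lra.
  have hout : \sum_(u | o v u && adj v u) y u <= d%:R * w v.
    apply: (@le_trans _ _ (\sum_(u | o v u && adj v u) w v)).
      by apply: ler_sum => u /andP[_ vu]; apply: yw; rewrite !inE adj_sym vu orbT.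
    rewrite sumr_const -[leLHS]mulr_natl ler_wpM2r // ler_nat.
    apply: leq_trans (o_deg v); apply/subset_leq_card/fintype.subsetP => u.
    by rewrite !inE => /andP[].
  have hk : (d.*2.+1)%:R * w v <= kappa%:R * w v.
    by rewrite ler_wpM2r // ler_nat.
  (* Of the load, at least [2 * d + 1] times [w v], the out-neighbours cover [d] times; [d + 1]
     times is left. *)
  have E1 : (d.*2.+1)%:R = d%:R + d.+1%:R :> K.
    by rewrite -natrD; congr (_%:R); lia.
  rewrite E1 mulrDl in hk; rewrite tight in hload.
  move: (\sum_(u | o u v) y u) (\sum_(u | o v u && adj v u) y u) hload hout hk.
  by move=> A B; lra.
rewrite big_split /= -natr1 addrC mulrDl mul1r.
have sub (P : pred G) (g : G -> K) : (forall v, 0 <= g v) -> \sum_(v | P v) g v <= \sum_v g v.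
  by move=> g0; rewrite big_mkcond; apply: ler_sum => v _; case: ifP.
apply: lerD; last exact: sub.
apply: le_trans (sub _ _ _) _; first by move=> v; apply: sumr_ge0.
(* After the exchange, [y u] is counted once per out-neighbour of [u], hence at most [d] times. *)
rewrite (exchange_big_dep predT) //= mulr_sumr; apply: ler_sum => u _.
rewrite sumr_const -[leLHS]mulr_natl ler_wpM2r // ler_nat.
by apply: leq_trans (o_deg u); apply/subset_leq_card/fintype.subsetP => v; rewrite !inE.
Qed.

Lemma greedy_cost (x : G -> K) : ds_lp_feasible x ->
  set_cost w D <= (kappa.*2)%:R * ds_lp_cost w x.
Proof.
move=> [x1 x0]; have [y [a [[y0 r0] yr yw _ [has DE]]]] := st.
(* Weak duality: the load of [v] is at most [kappa] times [w v]. *)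
have dual : \sum_u y u <= kappa%:R * ds_lp_cost w x.
  apply: (@le_trans _ _ (\sum_u y u * \sum_(v in closed_nbh u) x v)).
    by apply: ler_sum => u _; rewrite ler_peMr.
  under eq_bigr do rewrite mulr_sumr.
  rewrite (exchange_big_dep predT) //= /ds_lp_cost mulr_sumr.
  apply: ler_sum => v _; rewrite mulrA -mulr_suml ler_wpM2r //.
  rewrite -(yr v) /load; under eq_bigl do rewrite -closed_nbh_sym.
  by rewrite lerDl.
have split_cost : set_cost w D <=
    \sum_(v | load y v == kappa%:R * w v) w v + \sum_u y u.
  rewrite /set_cost (bigID (fun v => load y v == kappa%:R * w v)) /=; apply: lerD.
    rewrite big_mkcond [leRHS]big_mkcond; apply: ler_sum => v _.
    by case: (v \in D) => //=; case: ifP.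
  (* The [y u] are grouped by the vertex [a u]; a chosen vertex that is not tight was taken for its
     cost, which equals some [y u] of its group. *)
  rewrite [leRHS](partition_big a predT) //= big_mkcond; apply: ler_sum => v _.
  case: ifP => [/andP[]|_]; last exact: sumr_ge0.
  rewrite DE => /imsetP[u us ->] ntight; have [_ [<-|ra0]] := has u us; last first.
    by move: ntight; rewrite -(yr (a u)) ra0 addr0 eqxx.
  by rewrite (bigD1 u) //= lerDl sumr_ge0.
have := tight_cost y0 yw.
rewrite -mul2n natrM -mulrA; move: split_cost dual.
move: (\sum_(v | _) _) (\sum_u y u) (kappa%:R * _) => A B C; lra.
Qed.

End Cost.
End GreedyPacking.

Lemma min_ds_cost_le (R : realType) (G : sgraph) (c : G -> R) (D : {set G}) :
  dominating D -> min_ds_cost c <= set_cost c D.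
Proof. by move=> domD; apply: bigmin_le_cond. Qed.

Lemma integrality_gap (R : realType) (G : sgraph) (c : G -> R) (o : rel G) (d kappa : nat) :
  (forall v, 0 <= c v) -> (forall u v, adj u v -> o u v || o v u) ->
  (forall u, (#|[set v | o u v]| <= d)%N) -> (d.*2.+1 <= kappa)%N ->
  min_ds_cost c <= (kappa.*2)%:R * ds_lp_opt c.
Proof.
move=> c0 oadj odeg kd.
have [r [D st]] := greedy_run kappa c0 (enum_uniq G).
have sG u : u \in enum G by rewrite mem_enum.
have k0 : 0 < (kappa.*2)%:R :> R by rewrite ltr0n; lia.
rewrite -ler_pdivrMl //; apply: lb_le_inf.
  (* The all-ones vector is feasible, so the infimum is over a nonempty set. *)
  exists (ds_lp_cost c (fun=> 1)); exists (fun=> 1) => //; split=> // v.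
  by rewrite sumr_const ler1n card_gt0; apply/set0Pn; exists v; rewrite !inE eqxx.
move=> _ [x fx <-]; rewrite ler_pdivrMl //.
apply: le_trans (min_ds_cost_le c (greedy_dominating st sG)) _.
exact: (greedy_cost c0 st oadj odeg kd fx).
Qed.

(** * Correctness of the algorithm *)

(** For positive [n] with [k] bits, [2 ^ k] exceeds [n] by a factor of at most 2. Rounding numerator
    and denominator this way changes the quotient by a factor of at most 2 either way. *)
Lemma weight_bounds (M : nat) (c : rat) (p := nat_bits `|numq c|%N)
    (q := nat_bits `|denq c|%N) (W := (bval (weight M p q))%:R : rat) :
  0 <= c -> (size q <= M)%N ->
  c * (2 ^ M)%:R <= 2%:R * W /\ W <= 2%:R * (c * (2 ^ M)%:R).
Proof.
move=> c0 qM.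
have [c00|cn0] := eqVneq c 0.
  have -> : W = 0 by rewrite /W /p c00.
  by rewrite c00 !mul0r !mulr0.
set n := `|numq c|%N in p W *; set d := `|denq c|%N in q qM W *.
have n0 : (0 < n)%N by rewrite absz_gt0 numq_eq0.
have d0 : (0 < d)%N by rewrite absz_gt0 denq_neq0.
have cE : c = n%:R / d%:R.
  rewrite -[LHS]divq_num_den -[numq c]gez0_abs ?numq_ge0 //.
  by rewrite -[denq c]gez0_abs ?denq_ge0.
have [n1 n2] := nat_bits_bounds n0; have [d1 d2] := nat_bits_bounds d0.
rewrite -/p in n1 n2; rewrite -/q in d1 d2.
have WE : bval (weight M p q) = (2 ^ (size p + (M - size q)))%N.
  rewrite /weight; case: (p) (nat_bits_nonnil n0 : (0 < size p)%N) => // b p' _.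
  by rewrite bval_nseq /= muln1.
have W2 : (bval (weight M p q) * 2 ^ size q = 2 ^ size p * 2 ^ M)%N.
  by rewrite WE -!expnD; congr (_ ^ _)%N; lia.
have dR : 0 < d%:R :> rat by rewrite ltr0n.
rewrite cE mulrAC ler_pdivrMr // [2%:R * (_ / _)]mulrA ler_pdivlMr //.
rewrite /W -!natrM !ler_nat; move: (bval _) W2 => B W2.
move: (2 ^ size p)%N (2 ^ size q)%N (2 ^ M)%N W2 n1 n2 d1 d2 => Pp Qq MM W2 n1 n2 d1 d2.
have h1 : (B * Qq <= B * (2 * d))%N by rewrite leq_mul2l d1 orbT.
have h2 : (B * d <= B * Qq)%N by rewrite leq_mul2l (ltnW d2) orbT.
have h3 : (n * MM <= Pp * MM)%N by rewrite leq_mul2r (ltnW n2) orbT.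
have h4 : (Pp * MM <= 2 * n * MM)%N by rewrite leq_mul2r n1 orbT.
split; lia.
Qed.

Section Correctness.
Variables (G : sgraph) (c : G -> rat) (a : nat).
Hypothesis c0 : forall v, 0 <= c v.

Let V := enum G.
Let M := (\sum_(v <- V) size (nat_bits `|denq (c v)|))%N.
Let W (v : G) : rat := (bval (weight M (nat_bits `|numq (c v)|%N)
  (nat_bits `|denq (c v)|%N)))%:R.

Let W0 v : 0 <= W v. Proof. exact: ler0n. Qed.

Let inV v : v \in V. Proof. by rewrite /V mem_enum. Qed.

(** Loop invariant with [s1] processed and [s2] to come; [rev s1] appears because [greedy_step] adds
    vertices in front. *)
Lemma round_loop s1 s2 (E : G -> entry) :
  V = s1 ++ s2 -> (forall v, (bval (E v).1.1)%:R = W v) ->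
  greedy_state W (2 ^ a) (rev s1) (fun v => (bval (E v).1.2)%:R) [set v | (E v).2] ->
  exists E' r,
    tl (tfold round_step
      (enc_seq (fun u => enc_seq (fun v => enc_bool (adj u v)) V) s2)
      (Node (bits (nseq (size s1) false ++ [:: true])) (enc_seq (fun v => enc_entry (E v)) V)))
    = enc_seq (fun v => enc_entry (E' v)) V /\
    greedy_state W (2 ^ a) (rev V) r [set v | (E' v).2].
Proof.
elim: s2 s1 E => [|u s2 IHs] s1 E VE EW st.
  by exists E, (fun v => (bval (E v).1.2)%:R); rewrite VE cats0; split=> //; rewrite /= VE cats0.
have Vu : uniq V by exact: enum_uniq.
have us1 : u \notin s1.
  by move: Vu; rewrite VE cat_uniq => /and3P[_ /hasPn/(_ u (mem_head _ _))].
pose fl v := v \in closed_nbh u.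
have fl_has : has fl V.
  by apply/hasP; exists u; rewrite ?inV // /fl !inE eqxx.
pose row := [seq adj u v | v <- V].
have flE i : (i < size V)%N -> fl (nth u V i) =
    nth false row i || nth false (nseq (size s1) false ++ [:: true]) i.
  move=> iV; rewrite /row (nth_map u); last exact: iV.
  rewrite /fl !inE orbC; congr (_ || _).
  have -> : (nth u V i == u) = (i == size s1).
    have uE : u = nth u V (size s1) by rewrite VE nth_cat ltnn subnn.
    rewrite {2}uE nth_uniq // VE size_cat /=; lia.
  rewrite nth_cat size_nseq nth_nseq; case: ltngtP => //= [ilt|->].
    by rewrite nth_default //= subn_gt0.
  by rewrite subnn.
have [x xV [d [xu dE dmin stepE]]] := round_stepE E Vu fl_has flE.
rewrite /= -/V -(enc_seq_map enc_bool (adj u)) -/row stepE.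
set E' := updated _ _ _ _.
have -> : (false :: nseq (size s1) false ++ [:: true]) =
  nseq (size (rcons s1 u)) false ++ [:: true] by rewrite size_rcons.
apply: IHs; first by rewrite cat_rcons.
  by move=> v; rewrite -EW.
rewrite rev_rcons.
have -> : [set v | (E' v).2] = x |: [set v | (E v).2].
  by apply/setP => v; rewrite !inE /= orbC.
have dmin' v : v \in closed_nbh u -> (bval d <= bval (E v).1.1)%N /\ (bval d <= bval (E v).1.2)%N.
  move=> vu; have := dmin v (inV v) vu.
  by rewrite bval_key leq_min => /andP[].
apply: (@greedy_step _ _ _ _ W0 _ _ _ u x (bval d)%:R _ st) => //.
- by rewrite mem_rev.
- by rewrite dE bval_key -EW natr_min.
- by move=> v /dmin'[h1 h2]; rewrite -EW !ler_nat.
- move=> v; rewrite /E' /updated /= -/(fl v); case: ifP => // vu.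
  by have [_ h] := dmin' v vu; rewrite bval_sub_bits // natrB.
Qed.

Lemma tgreedyE xs : exists (D : {set G}) r,
  tgreedy a (Node (enc_seq (fun u => enc_seq (fun v => enc_bool (adj u v)) V) V)
    (Node (enc_seq (fun v => enc_rat (c v)) V) xs)) = enc_vertex_set D /\
  greedy_state W (2 ^ a) (rev V) r D.
Proof.
rewrite /tgreedy /=.
have -> : enc_seq (fun v => enc_rat (c v)) V =
  enc_seq (enc_frac (fun v => nat_bits `|numq (c v)|%N)
                    (fun v => nat_bits `|denq (c v)|%N)) V by [].
rewrite tinitE -/M.
pose w v := weight M (nat_bits `|numq (c v)|%N) (nat_bits `|denq (c v)|%N).
pose E v : entry := (w v, nseq a false ++ w v, false).
have [||E' [r [outE st]]] := @round_loop [::] V E erefl.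
- by [].
- have -> : [set v | (E v).2] = set0 by apply/setP => v; rewrite !inE.
  have bE v : (bval (E v).1.2)%:R = (2 ^ a)%:R * W v by rewrite /= bval_nseq natrM.
  (* The initial budgets agree with those of [greedy_init] only pointwise, so its witnesses are
     repackaged. *)
  have [y [b [[y0 r0] yr ? ? [_ D0]]]] := greedy_init (2 ^ a) W0.
  exists y, b; split=> //; first by move=> v; rewrite bE.
exists [set v | (E' v).2], r; split=> //.
rewrite outE tfold_out_step /enc_vertex_set.
by apply: eq_in_enc_seq => v _; rewrite inE.
Qed.

(** Rounding costs a factor of 2 in the cost of [D] and another in the value of the linear
    program. *)
Lemma greedy_weight_cost r D (o : rel G) (d : nat) (x : G -> rat) :
  greedy_state W (2 ^ a) (rev V) r D ->
  (forall u v, adj u v -> o u v || o v u) ->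
  (forall u, (#|[set v | o u v]| <= d)%N) -> (d.*2.+1 <= 2 ^ a)%N ->
  ds_lp_feasible x ->
  set_cost c D <= ((4 * 2 ^ a).*2)%:R * ds_lp_cost c x.
Proof.
move=> st oadj odeg da fx.
have := greedy_cost W0 st oadj odeg da fx.
have M0 : 0 < (2 ^ M)%:R :> rat by rewrite ltr0n expn_gt0.
have bounds v : c v * (2 ^ M)%:R <= 2%:R * W v /\ W v <= 2%:R * (c v * (2 ^ M)%:R).
  apply: weight_bounds => //.
  by rewrite /M (big_rem v) ?inV //= leq_addr.
have h1 : set_cost c D * (2 ^ M)%:R <= 2%:R * set_cost W D.
  by rewrite mulr_suml mulr_sumr; apply: ler_sum => v _; have [] := bounds v.
have h2 : ds_lp_cost W x <= 2%:R * (ds_lp_cost c x * (2 ^ M)%:R).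
  rewrite mulr_suml mulr_sumr; apply: ler_sum => v _.
  rewrite mulrAC mulrA ler_wpM2r //; last by have [] := bounds v.
  by case: fx.
move=> h3; rewrite -(ler_pM2r M0); apply: le_trans h1 _.
have k0 : 0 <= ((2 ^ a).*2)%:R :> rat by exact: ler0n.
have h4 := ler_wpM2l k0 h2.
have -> : ((4 * 2 ^ a).*2)%:R = 4%:R * ((2 ^ a).*2)%:R :> rat.
  by rewrite -natrM; congr (_%:R); lia.
rewrite mulrCA in h4; rewrite -!mulrA; move: (le_trans h3 h4).
by move: (set_cost W D) ((2 ^ a).*2%:R * _) => A B; lra.
Qed.

End Correctness.

(** * The approximation theorem *)

Lemma poly_time_of_ptime (I : Type) (O : I -> Type)
    (encI : I -> tree) (encO : forall i, O i -> tree)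
    (pre : I -> Prop) (post : forall i, O i -> Prop) f :
  ptime f ->
  (forall i, pre i -> exists o : O i, f (encI i) = encO i o /\ post i o) ->
  poly_time_solvable encI encO pre post.
Proof.
(* A tree size [n] is positive, so [n + 2 <= 3 * n]; with [k <= 3 ^ k], the number [3 ^ k] serves
   both as factor and as exponent. *)
move=> [p [m [b [[k bk] _ hp]]]] hf; exists p, (3 ^ k)%N => i prei.
have [o [fo posto]] := hf i prei; exists o.
have [n [s [ex s0 _ nb _]]] := hp (upd (fun=> Leaf) 0 (encI i)).
rewrite upd_same fo in s0 nb; exists n; split=> //; first by exists s.
apply: leq_trans nb _; apply: leq_trans (bk _) _.
apply: leq_trans (leq_addr _ _).
have t0 := tree_size_gt0 (encI i).
apply: (@leq_trans ((3 * tree_size (encI i)) ^ k)).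
  by case: (k) => // k'; rewrite leq_exp2r //; lia.
rewrite expnMn leq_mul2l; apply/orP; right.
by apply: leq_pexp2l => //; apply: ltnW; apply: ltn_expl.
Qed.

Theorem theorem3 (R : realType) (F : sgraph -> Prop)
    (hclosed : minor_closed F) (hproper : proper_family F) :
  exists cF : R,
    (forall (G : sgraph) (c : G -> R), F G -> (forall v, 0 <= c v) ->
       min_ds_cost c <= cF * ds_lp_opt c)
    /\
    poly_time_solvable
      (I := ds_instance) (O := fun i => {set ds_graph i})
      enc_ds_instance (fun i => @enc_vertex_set (ds_graph i))
      (fun i => [/\ F (ds_graph i), (forall v, 0 <= @ds_cost i v)
                  & ds_lp_feasible (@ds_sol i)])
      (fun i D => dominating D /\
         ratr (set_cost (@ds_cost i) D)
           <= cF * ratr (ds_lp_cost (@ds_cost i) (@ds_sol i))).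
Proof.
have [d orient] := minor_closed_orientation hclosed hproper.
pose a := d.*2.+1.
have da : (d.*2.+1 <= 2 ^ a)%N by apply: ltnW; apply: ltn_expl.
(* The packing gives [2 * 2 ^ a] and rounding a further 4. The integrality gap is taken with
   [kappa = 4 * 2 ^ a] to reach the same constant. *)
exists ((4 * 2 ^ a).*2)%:R; split.
  move=> G c FG c0; have [o [oadj odeg]] := orient G FG.
  by apply: integrality_gap oadj odeg _ => //; lia.
apply: poly_time_of_ptime (ptime_tgreedy a) _ => -[G c x] [/= FG c0 fx].
have [o [oadj odeg]] := orient G FG.
have [D [r [outD st]]] := tgreedyE c a (enc_seq (fun v => enc_rat (x v)) (enum G)).
exists D; split=> //; split.
  by apply: (greedy_dominating st) => u; rewrite mem_rev mem_enum.
rewrite -(ratr_nat R) -rmorphM ler_rat.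
exact: (greedy_weight_cost c0 st oadj odeg da fx).
Qed.
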